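(* Suppose $G$ is a finitely generated group and $\Delta>0$, and let $\mathrm{Hom}_\Delta(G)$ be the set of all homomorphisms of $G$ into $\mathrm{Isom}(X)$, for all geodesic spaces $X$ with $\Delta$-thin triangles. Then the image of $L:\mathrm{Hom}_\Delta(G)\to\mathrm{LF}(G)$ has compact closure in $\overline{\mathrm{LF}(G)}=\mathrm{LF}(G)\cup\mathbb P\mathrm{LF}(G)$. Every point of $\mathbb P\mathrm{LF}(G)$ lying in the closure of the image of $L$ is the projectivized length function of an action of $G$ by isometries on an $\mathbb R$-tree which has no global fixed point.
   Context: A path-metric space is a metric space in which the distance between two points is the infimum of the lengths of paths joining them. A geodesic is an arc whose length equals the distance between its endpoints; a geodesic space is a path-metric space in which every pair of points is joined by a geodesic. A triangle (three geodesics $[a,b],[b,c],[c,a]$) is $\Delta$-thin if each side is contained in the $\Delta$-neighborhood of the union of the other two. A geodesic space has $\Delta$-thin triangles if every triangle in it is $\Delta$-thin. For $\rho:G\to\mathrm{Isom}(X)$, $L(\rho):G\to\mathbb R$ is $L(\rho)(g)=\inf\{d_X(x,\rho(g)x):x\in X\}$. A length function on $G$ is a map $G\to\mathbb R$; $\mathrm{LF}(G)=\mathbb R^G$ with the product topology. $\mathbb P\mathrm{LF}(G)=(\mathrm{LF}(G)-0)/(\mathbb R-0)$ with the quotient topology. $\overline{\mathrm{LF}(G)}=\mathrm{LF}(G)\cup\mathbb P\mathrm{LF}(G)$ contains $\mathrm{LF}(G)$ as an embedded subspace and is topologized so that a sequence $L_n\in\mathrm{LF}(G)$ converges to $[L]\in\mathbb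 P\mathrm{LF}(G)$ if and only if there are $\lambda_n\to0$ with $\lambda_nL_n\to L$ in $\mathrm{LF}(G)$. An $\mathbb R$-tree is a path-metric space in which any two points are the endpoints of a unique arc, and this arc is isometric to an interval in $\mathbb R$. A global fixed point is a point fixed by every element of $G$. *)

(* Defs.v *)
From HB Require Import structures.
From mathcomp Require Import all_boot all_order all_algebra.
From mathcomp Require Import generic_quotient.
From mathcomp Require Import all_classical all_reals all_analysis.
Set Implicit Arguments.
Unset Strict Implicit.
Unset Printing Implicit Defensive.
Import Order.TTheory GRing.Theory Num.Theory.
Import numFieldNormedType.Exports.

Local Open Scope classical_set_scope.
Local Open Scope ring_scope.
Local Open Scope quotient_scope.

Section MetricSpaces.
Context {R : realType} {X : metricType R}.
Implicit Types (x y : X) (a b : R) (gamma : R -> X) (A B C S : set X).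

Definition path_length a b gamma : \bar R :=
  ereal_sup [set (\sum_(0 <= i < size s)
      mdist (gamma (nth b (a :: s) i)) (gamma (nth b (a :: s) i.+1)))%:E
    | s in itv_partition a b].

Definition is_path a b gamma x y :=
  [/\ a <= b, {within `[a, b], continuous gamma}, gamma a = x & gamma b = y].

(* The degenerate parameter interval a = b is allowed, so that {x} is the
   (only) arc from x to x. *)
Definition arc_param a b gamma x y A :=
  [/\ is_path a b gamma x y, {in `[a, b] &, injective gamma}
    & gamma @` `[a, b] = A].

Definition is_arc x y A := exists a b gamma, arc_param a b gamma x y A.

Definition is_geodesic x y A := exists a b gamma,
  arc_param a b gamma x y A /\ path_length a b gamma = (mdist x y)%:E.

Definition nbhd_of (r : R) S : set X := [set x | exists2 y, S y & mdist x y < r].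

Definition thin_triangle (Delta : R) A B C :=
  [/\ A `<=` nbhd_of Delta (B `|` C), B `<=` nbhd_of Delta (C `|` A)
    & C `<=` nbhd_of Delta (A `|` B)].

Definition isometric_to_interval A := exists (i : interval R) (f : R -> X),
  {in i &, forall s t, mdist (f s) (f t) = `|s - t|} /\ f @` [set` i] = A.

End MetricSpaces.

(* Metric spaces are nonempty; this is needed for the infimum defining the
   length function of an action to make sense. *)
Definition path_metric_space (R : realType) (X : metricType R) :=
  [set: X] !=set0 /\
  forall x y : X, (mdist x y)%:E = ereal_inf
    [set l | exists a b gamma, is_path a b gamma x y /\ l = path_length a b gamma].

Definition geodesic_space (R : realType) (X : metricType R) :=
  path_metric_space X /\ forall x y : X, exists A, is_geodesic x y A.

Definition has_thin_triangles (R : realType) (Delta : R) (X : metricType R) :=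
  forall (a b c : X) (A B C : set X),
    is_geodesic a b A -> is_geodesic b c B -> is_geodesic c a C ->
    thin_triangle Delta A B C.

Definition R_tree (R : realType) (X : metricType R) :=
  path_metric_space X /\
  forall x y : X, exists A : set X,
    [/\ is_arc x y A, forall B, is_arc x y B -> B = A
      & isometric_to_interval A].

Section IsometryGroup.
Context {R : realType} (X : metricType R).

Record Isom := MkIsom {
  isom_fun :> X -> X;
  isom_mdist : forall x y, mdist (isom_fun x) (isom_fun y) = mdist x y;
  isom_surj : forall y, exists x, isom_fun x = y }.

Lemma isomP (f g : Isom) : (forall x, f x = g x) -> f = g.
Proof.
case: f g => [f fd fs] [g gd gs] /= /funext fg; rewrite {}fg in fd fs *.
by congr MkIsom; exact: Prop_irrelevance.
Qed.

HB.instance Definition _ := gen_eqMixin Isom.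
HB.instance Definition _ := gen_choiceMixin Isom.

Lemma isom_inj (f : Isom) : injective f.
Proof.
by move=> x y fxy; apply/mdist_positivity; rewrite -(isom_mdist f) fxy mdistxx.
Qed.

Definition isom_one : Isom :=
  @MkIsom id (fun _ _ => erefl) (fun y => ex_intro _ y erefl).

Lemma comp_isom_mdist (f g : Isom) x y : mdist (f (g x)) (f (g y)) = mdist x y.
Proof. by rewrite !isom_mdist. Qed.

Lemma comp_isom_surj (f g : Isom) y : exists x, f (g x) = y.
Proof.
by have [z <-] := isom_surj f y; have [x <-] := isom_surj g z; exists x.
Qed.

Definition isom_mul (f g : Isom) : Isom :=
  @MkIsom (f \o g) (comp_isom_mdist f g) (comp_isom_surj f g).

Definition isom_inv_fun (f : Isom) y : X := sval (cid (isom_surj f y)).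

Lemma isom_inv_funK (f : Isom) y : f (isom_inv_fun f y) = y.
Proof. exact: svalP (cid (isom_surj f y)). Qed.

Lemma isom_inv_mdist (f : Isom) x y :
  mdist (isom_inv_fun f x) (isom_inv_fun f y) = mdist x y.
Proof. by rewrite -(isom_mdist f) !isom_inv_funK. Qed.

Lemma isom_inv_surj (f : Isom) y : exists x, isom_inv_fun f x = y.
Proof. by exists (f y); apply: (@isom_inj f); rewrite isom_inv_funK. Qed.

Definition isom_inv (f : Isom) : Isom :=
  @MkIsom (isom_inv_fun f) (isom_inv_mdist f) (isom_inv_surj f).

Fact isom_mulA : associative isom_mul.
Proof. by move=> f g h; exact: isomP. Qed.

Fact isom_mul1 : left_id isom_one isom_mul.
Proof. by move=> f; exact: isomP. Qed.

Fact isom_mulr1 : right_id isom_one isom_mul.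
Proof. by move=> f; exact: isomP. Qed.

Fact isom_mulV : left_inverse isom_one isom_inv isom_mul.
Proof.
by move=> f; apply: isomP => x; apply: (@isom_inj f); rewrite /= isom_inv_funK.
Qed.

Fact isom_mulrV : right_inverse isom_one isom_inv isom_mul.
Proof. by move=> f; apply: isomP => x; rewrite /= isom_inv_funK. Qed.

HB.instance Definition _ :=
  isGroup.Build Isom isom_mulA isom_mul1 isom_mulr1 isom_mulV isom_mulrV.

End IsometryGroup.

Definition finitely_generated (G : groupType) := exists s : seq G,
  forall H : {pred G}, group_closed H -> {subset s <= H} -> forall g, g \in H.

Section LengthFunctions.
Context (R : realType) (G : groupType).

Definition LF := {ptws G -> R}.
HB.instance Definition _ := Topological.on LF.

Definition LF0 : LF := fun=> 0.

Definition LF_nz : Type := [set L : LF | L <> LF0].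
HB.instance Definition _ := Topological.on LF_nz.

Definition scale_rel : rel LF_nz := fun L M =>
  `[< exists2 c : R, c != 0 & forall g, set_val M g = c * set_val L g >].

Lemma scale_rel_refl : reflexive scale_rel.
Proof. by move=> L; apply/asboolP; exists 1 => [|g]; rewrite ?oner_eq0 ?mul1r. Qed.

Lemma scale_rel_sym : symmetric scale_rel.
Proof.
suff H L M : scale_rel L M -> scale_rel M L by move=> L M; apply/idP/idP => /H.
move=> /asboolP[c c0 LM]; apply/asboolP.
by exists c^-1 => [|g]; rewrite ?invr_eq0// LM mulKf.
Qed.

Lemma scale_rel_trans : transitive scale_rel.
Proof.
move=> M L N /asboolP[c c0 LM] /asboolP[d d0 MN]; apply/asboolP.
by exists (d * c) => [|g]; rewrite ?mulf_neq0// MN LM mulrA.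
Qed.

Canonical scale_equiv :=
  EquivRel scale_rel scale_rel_refl scale_rel_sym scale_rel_trans.

Definition PLF := quotient_topology {eq_quot scale_equiv}.
HB.instance Definition _ := Topological.on PLF.

Definition projectivize (L : LF_nz) : PLF := \pi_PLF L.

(* L is nonzero and p is its projective class *)
Definition projectivizes_to (L : LF) (p : PLF) :=
  exists2 M : LF_nz, set_val M = L & projectivize M = p.

Definition LFbar := (LF + PLF)%type.
HB.instance Definition _ := Choice.on LFbar.

(* LFbar is the projective completion of LF, that is, the quotient of
   (LF * R) - 0 by the scaling action of R - 0, where L : LF corresponds to the
   class of (L, 1) and the class of L in PLF to the class of (L, 0).
   [LFbar_cone U] is the preimage of U in (LF * R) - 0. *)
Definition LFbar_cone (U : set LFbar) : set (LF * R) :=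
  [set v | v.2 != 0 /\ U (inl (fun g => v.1 g / v.2))] `|`
  [set v | v.2 = 0 /\ exists2 p, projectivizes_to v.1 p & U (inr p)].

Definition LFbar_open (U : set LFbar) := open (LFbar_cone U).

Lemma projectivizes_to_fun L p q :
  projectivizes_to L p -> projectivizes_to L q -> p = q.
Proof. by move=> [M ML <-] [N NL <-]; congr projectivize; apply/val_inj; rewrite -!set_valE ML. Qed.

Lemma LF_hausdorff : hausdorff_space LF.
Proof. by apply: hausdorff_product => _; exact: Rhausdorff. Qed.

Lemma LFbar_openT : LFbar_open setT.
Proof.
rewrite /LFbar_open.
have -> : LFbar_cone setT = ~` [set v | v.1 = LF0 /\ v.2 = 0].
  apply/seteqP; split=> [[L t] [[/= t0 _] [_ /eqP]|[/= t0 [p [M ML _] _]] [L0 _]]|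
      [L t] /= /not_andP h].
  - by rewrite (negbTE t0).
  - by have /set_mem := valP M; apply; rewrite -set_valE ML.
  - have [t0|t0] := eqVneq t 0; last by left.
    right; split => //; case: h => // L0.
    pose M : LF_nz := exist _ L (mem_set (L0 : [set L : LF | L <> LF0] L)).
    by exists (projectivize M) => //; exists M.
have -> : [set v : LF * R | v.1 = LF0 /\ v.2 = 0] =
    fst @^-1` [set LF0] `&` snd @^-1` [set 0] by [].
apply: closed_openC; apply: closedI.
  apply: closed_comp => [v _|]; first exact: cvg_fst.
  exact/accessible_closed_set1/hausdorff_accessible/LF_hausdorff.
apply: closed_comp => [v _|]; first exact: cvg_snd.
exact/accessible_closed_set1/hausdorff_accessible/Rhausdorff.
Qed.

Lemma LFbar_openI : setI_closed LFbar_open.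
Proof.
move=> U V oU oV; rewrite /LFbar_open.
suff -> : LFbar_cone (U `&` V) = LFbar_cone U `&` LFbar_cone V by exact: openI.
apply/seteqP; split=> v.
  by case=> [[v0 [Uv Vv]]|[v0 [p vp [Up Vp]]]]; split; try (by left);
    right; split => //; exists p.
move=> [[[v0 Uv]|[v0 [p vp Up]]] [[v0' Vv]|[v0' [q vq Vq]]]].
- by left.
- by rewrite v0' eqxx in v0.
- by rewrite v0 eqxx in v0'.
- right; split => //; exists p => //; split => //.
  by rewrite (projectivizes_to_fun vp vq).
Qed.

Lemma LFbar_open_bigcup (I : Type) (F : I -> set LFbar) :
  (forall i, LFbar_open (F i)) -> LFbar_open (\bigcup_i F i).
Proof.
move=> oF; rewrite /LFbar_open.
suff -> : LFbar_cone (\bigcup_i F i) = \bigcup_i LFbar_cone (F i).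
  by apply: bigcup_open => i _; exact: oF.
apply/seteqP; split=> v.
  case=> [[v0 [i _ Fi]]|[v0 [p vp [i _ Fi]]]]; exists i => //; first by left.
  by right; split => //; exists p.
move=> [i _ [[v0 Fi]|[v0 [p vp Fi]]]]; first by left; split => //; exists i.
by right; split => //; exists p => //; exists i.
Qed.

HB.instance Definition _ :=
  isOpenTopological.Build LFbar LFbar_openT LFbar_openI LFbar_open_bigcup.

Definition length_function (X : metricType R)
    (rho : {multiplicative G -> Isom X}) : LF :=
  fun g => inf [set mdist x (rho g x) | x in [set: X]].

(* the image of L : Hom_Delta(G) -> LF(G) *)
Definition length_functions_thin (Delta : R) : set LF :=
  [set L | exists (X : metricType R) (rho : {multiplicative G -> Isom X}),
    [/\ geodesic_space X, has_thin_triangles Delta X & L = length_function rho]].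

Definition global_fixed_point (X : metricType R)
    (rho : {multiplicative G -> Isom X}) (x : X) :=
  forall g, rho g x = x.

End LengthFunctions.

Arguments length_functions_thin {R} G Delta.

(* LF is an embedded subspace of LFbar (inl_embedding), and convergence to points of
   PLF is as expected (cvg_LFbarP). *)
Section CompletionFacts.
Context (R : realType) (G : groupType).
Local Notation LF := (LF R G).
Local Notation LFbar := (LFbar R G).

Lemma LF_cvgP (T : Type) (F : set_system T) (FF : Filter F) (f : T -> LF) (L : LF) :
  (f @ F --> L) <-> forall g, f t g @[t --> F] --> L g.
Proof.
have img g : (fun h : LF => h g) @` setT = setT.
  by rewrite eqEsubset; split=> v // _; exists (cst v).
split=> [/cvg_sup h g|h].
  have := h g; rewrite cvg_image//.
  move=> + W WL => /(_ W WL)[W' FW' <-].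
  by apply: (@filterS _ F _ (f @^-1` W')) => // t W't /=; exists (f t).
apply/cvg_sup => g; rewrite cvg_image//.
move=> W /(h g) Q; exists (@^~ g @^-1` W) => //.
by rewrite eqEsubset; split => [j [? + <-//]|j Wj]; exists (fun _ => j).
Qed.

Lemma LF_eval_cont (g : G) (L : LF) : (fun M : LF => M g) @ nbhs L --> L g.
Proof. exact: (LF_cvgP _ id L).1. Qed.

Lemma inl_embedding (U : set LF) :
  open U <-> exists2 V : set LFbar, open V & (inl : LF -> LFbar) @^-1` V = U.
Proof.
split=> [oU|[V oV <-]].
  exists (inl @` U); last first.
    by apply/seteqP; split=> L /= => [[M UM [<-]]|UL] //; exists L.
  have -> : @open LFbar (inl @` U) = open (LFbar_cone (inl @` U)) by [].
  rewrite openE => v [[v0 [M UM [ME]]]|[v0 [p vp [//]]]].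
  rewrite /interior.
  have h : ((fun g => w.1 g / w.2) : LF) @[w --> v] --> M.
    apply: ((@LF_cvgP _ (nbhs v) _ (fun w g => w.1 g / w.2) M).2) => g.
    rewrite ME.
    have c1 : w.1 g @[w --> v] --> v.1 g.
      exact: (cvg_comp fst (fun M : LF => M g) cvg_fst (@LF_eval_cont g v.1)).
    have c2 : w.2 @[w --> v] --> v.2 by exact: cvg_snd.
    have c3 : (w.2)^-1 @[w --> v] --> (v.2)^-1.
      exact: (@cvgV R _ (nbhs v) _ (fun w : LF * R => w.2) _ v0 c2).
    exact: (@cvgM R _ (nbhs v) _ (fun w : LF * R => w.1 g) (fun w => (w.2)^-1) _ _ c1 c3).
  have nM : nbhs M U by apply: open_nbhs_nbhs.
  have nv : \forall w \near v, w.2 != 0.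
    have c2 : snd @ nbhs v --> v.2 by exact: cvg_snd.
    exact: (cvgr_neq0 _ c2).
  near=> w; left; split; first by near: w.
  by exists (fun g => w.1 g / w.2) => //; near: w; exact: h.
have oc : open (LFbar_cone V) by exact: oV.
have -> : inl @^-1` V = (fun L : LF => (L, 1 : R)) @^-1` LFbar_cone V.
  apply/seteqP; split=> L /=.
    move=> VL; left; split => /=; first exact: oner_neq0.
    by have -> : (fun g : G => L g / 1) = L by apply/funext => g; rewrite divr1.
  move=> [[_]|[/= /eqP]]; last by rewrite oner_eq0.
  by have -> : (fun g : G => L g / 1) = L by apply/funext => g; rewrite divr1.
apply: open_comp oc => L _.
exact: (@cvg_pair LF LF R (nbhs L) (nbhs L) (nbhs (1 : R)) _ _ _ id (cst 1)
  cvg_id (cvg_cst _)).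
Unshelve. all: by end_near. Qed.

Lemma cvg_LFbarP (T : Type) (F : set_system T) (FF : Filter F)
    (f : T -> LF) (L : LF) (p : PLF R G) : projectivizes_to L p ->
  (inl (f t) : LFbar) @[t --> F] --> (inr p : LFbar) <->
  exists lam : T -> R, lam @ F --> (0 : R) /\
    ((fun g => lam t * f t g) : LF) @[t --> F] --> L.
Proof.
move=> Lp; split=> [h|[lam [lam0 lamf]]].
  have [g0 Lg0] : exists g0, L g0 != 0.
    case: Lp => M ML _; have /set_mem/= := valP M; rewrite -set_valE ML.
    apply: contra_notP => /forallNP L0; apply/funext => g.
    by apply/eqP; apply: contraPT (L0 g) => ? /(_ _); apply.
  pose phi (v : LF * R) : LF * R :=
    ((fun g => L g0 / v.1 g0 * v.1 g), L g0 / v.1 g0 * v.2).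
  have phiL : phi (L, 0) = (L, 0).
    by rewrite /phi/= mulr0 divff//; congr pair; apply/funext => g; rewrite mul1r.
  have phic (v : LF * R) : v.1 g0 != 0 -> phi @ nbhs v --> phi v.
    move=> v0.
    have c1 g : w.1 g @[w --> v] --> v.1 g.
      exact: (cvg_comp fst (fun M : LF => M g) cvg_fst (@LF_eval_cont g v.1)).
    have c : L g0 / w.1 g0 @[w --> v] --> L g0 / v.1 g0.
      
      have c2 : (w.1 g0)^-1 @[w --> v] --> (v.1 g0)^-1.
        exact: (@cvgV R _ (nbhs v) _ (fun w : LF * R => w.1 g0) _ v0 (c1 g0)).
      have c3 : L g0 @[_ --> nbhs v] --> L g0 by exact: cvg_cst.
      exact: (@cvgM R _ (nbhs v) _ (fun _ => L g0) (fun w => (w.1 g0)^-1) _ _ c3 c2).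
    have c2 : L g0 / w.1 g0 * w.2 @[w --> v] --> L g0 / v.1 g0 * v.2.
      apply: (@cvgM R _ (nbhs v) _ (fun w => L g0 / w.1 g0) (fun w : LF * R => w.2) _ _ c).
      exact: cvg_snd.
    have c3 : ((fun g => L g0 / w.1 g0 * w.1 g) : LF) @[w --> v] --> (phi v).1.
      apply: ((@LF_cvgP _ (nbhs v) _ (fun w g => L g0 / w.1 g0 * w.1 g) _).2) => g.
      exact: (@cvgM R _ (nbhs v) _ (fun w => L g0 / w.1 g0) (fun w : LF * R => w.1 g) _ _ c (c1 g)).
    exact: (@cvg_pair _ _ _ (nbhs v) (nbhs (phi v).1) (nbhs (phi v).2) _ _ _ _ _ c3 c2).
  have phiZ (c : R) (v : LF * R) : c != 0 -> phi ((fun g => c * v.1 g), c * v.2) = phi v.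
    move=> c0; have [v0|v0] := eqVneq (v.1 g0) 0.
      rewrite /phi/= v0 mulr0 invr0 mulr0 !mul0r; congr pair.
      by apply/funext => g; rewrite !mul0r.
    rewrite /phi/=; congr pair; [apply/funext => g|];
      by rewrite invfM mulrA -(mulrA _ _ c) (mulrAC _ _ c) mulVf// mul1r.
  exists (fun t => L g0 / f t g0).
  suff : phi (f t, 1) @[t --> F] --> phi (L, 0).
    rewrite phiL => hc; split.
      have /(cvg_comp _ _ hc) : snd @ nbhs ((L, 0) : LF * R) --> (0:R) by exact: cvg_snd.
      by apply: cvg_trans; apply: near_eq_cvg; apply: nearW => t /=; rewrite mulr1.
    have /(cvg_comp _ _ hc) : fst @ nbhs ((L, 0) : LF * R) --> L by exact: cvg_fst.
    by apply: cvg_trans; apply: near_eq_cvg; apply: nearW.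
  move=> N /=; rewrite nbhsE => -[N' [oN' N'L] N'N].
  apply: filterS N'N _.
  pose V : set LFbar := [set x | match x with
     | inl M => M g0 != 0 /\ N' (phi (M, 1))
     | inr q => exists2 M, projectivizes_to M q & M g0 != 0 /\ N' (phi (M, 0))
     end].
  have coneV : LFbar_cone V = [set v | v.1 g0 != 0 /\ N' (phi v)].
    apply/seteqP; split=> -[M s] /=.
      move=> [[/= s0 [Mg N'M]]|[/= -> [q Mq [M' M'q [M'g N'M']]]]].
        have sg : M g0 != 0 by apply: contraNneq Mg => ->; rewrite mul0r.
        split => //; have := phiZ s ((fun g => M g / s), 1) s0.
        rewrite /= mulr1 => E; move: N'M; rewrite -E; congr (N' (phi (_, _))).
        by apply/funext => g; rewrite mulrCA divff// mulr1.
      have [c c0 ME] : exists2 c, c != 0 & M = (fun g => c * M' g).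
        case: Mq M'q => [M1 <- <-] [M2 <-] /eqmodP/asboolP[c c0 E].
        by exists c => //; apply/funext => g; exact: E.
      rewrite ME mulf_neq0//; split => //.
      by have := phiZ c (M', 0) c0; rewrite /= mulr0 => ->.
    move=> [Mg N'M]; have [s0|s0] := eqVneq s 0; [right|left]; split => //=.
      have Mn : M <> @LF0 R G by move=> M0; rewrite M0 eqxx in Mg.
      pose Mz : LF_nz R G := exist _ M (mem_set (Mn : [set L : LF | L <> @LF0 R G] M)).
      exists (projectivize Mz); first by exists Mz.
      exists M; first by exists Mz.
      by split => //; rewrite s0 in N'M.
    split; first by rewrite mulf_neq0// invr_neq0.
    have := phiZ s^-1 (M, s); rewrite invr_neq0//= mulVf// => /(_ isT) E.
    move: N'M; rewrite -E; congr (N' (phi (_, _))).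
    by apply/funext => g; rewrite mulrC.
  have oV : open V.
    have -> : @open LFbar V = open (LFbar_cone V) by [].
    rewrite coneV openE => v [vg N'v]; rewrite /interior.
    have nN : nbhs (phi v) N' by apply: open_nbhs_nbhs.
    have h1 : \forall w \near v, w.1 g0 != 0.
      have c1 : w.1 g0 @[w --> v] --> v.1 g0.
        exact: (cvg_comp fst (fun M : LF => M g0) cvg_fst (@LF_eval_cont g0 v.1)).
      exact: (cvgr_neq0 _ c1).
    by near=> w; split; near: w => //; exact: phic.
  have Vp : V (inr p) by exists L => //; rewrite phiL in N'L *.
  have nV : nbhs (inr p : LFbar) V by apply: open_nbhs_nbhs.
  apply: (@filterS _ F _ ((fun t => inl (f t) : LFbar) @^-1` V)) => [t []//|].
  exact: h.
move=> U /=; rewrite nbhsE => -[V [oV Vp] VU].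
apply: filterS VU _.
have oc : open (LFbar_cone V) by exact: oV.
have cv : ((fun g => lam t * f t g) : LF, lam t) @[t --> F] --> ((L, 0) : LF * R).
  exact: (@cvg_pair _ _ _ F _ _ _ _ _ _ _ lamf lam0).
have nV : nbhs ((L, 0) : LF * R) (LFbar_cone V).
  by apply: open_nbhs_nbhs; split => //; right; split => //; exists p.
apply: (@filterS _ F _ _ _ _ (cv _ nV)) => t [[/= l0]|[/= l0 [q [M ME _] _]]].
  by congr V; congr inl; apply/funext => g; rewrite mulrAC divff// mul1r.
have /set_mem/= := valP M; rewrite -set_valE ME; case.
by apply/funext => g; rewrite l0 mul0r.
Unshelve. all: by end_near. Qed.
End CompletionFacts.

(* Main.v *)
(** Let [X] be geodesic with [Delta]-thin triangles. Every side of a triangle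
    contains, by connectedness, a point close to both other sides; comparing two
    such points yields the four-point inequality with error [4 * Delta].

    Compactness. If [G] acts on [X] and every [s] and [s^-1 * t], for [s] and
    [t] in a finite generating set, has translation length at most [l], then
    some point is moved by at most [l + 84 * Delta] by every generator: at a
    point almost minimizing the maximal displacement two generators would
    otherwise pull in opposite directions and [s^-1 * t] would translate a lot.
    Hence [L g <= n g * (l + 84 * Delta)] with [n g] the word length of [g], and
    the nonzero [(L, t)] satisfying the homogeneous form of this bound make up
    the cone over a closed compact subset of [LFbar].

    Trees. Along an ultrafilter on the image of the length functions converging
    to a point of [PLF], the metrics, rescaled by factors tending to [0] and
    based at points moved by a bounded amount, have a geodesic ultralimit
    satisfying the four-point inequality without error, i.e. an R-tree. There
    the midpoint of [x] and [g x] realizes the limit of the translation lengths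
    of [g], so the length function of the limit action is the limit of the
    rescaled length functions. It is not zero, so there is no fixed point. *)
Require Import Defs.
From HB Require Import structures.
From mathcomp Require Import all_boot all_order all_algebra.
From mathcomp Require Import generic_quotient.
From mathcomp Require Import all_classical all_reals all_analysis.
From mathcomp Require Import ring lra.
Set Implicit Arguments.
Unset Strict Implicit.
Unset Printing Implicit Defensive.
Import Order.TTheory GRing.Theory Num.Theory.
Import numFieldNormedType.Exports.

Local Open Scope classical_set_scope.
Local Open Scope ring_scope.

(** * Geodesic spaces with thin triangles *)

Section Basics.
Context {R : realType} {X : metricType R}.
Implicit Types (x y z w : X) (delta t : R).

(** Gromov hyperbolicity, with the error measured on distances; it is also the loss per step for the
    doubled products [gromov]. *)
Definition four_point delta := forall x y z w,
  mdist x z + mdist y w <=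
    Num.max (mdist x y + mdist z w) (mdist y z + mdist x w) + delta.

(** This trace of the existence of geodesics mentions no path, so it passes to ultralimits. *)
Definition interpolable := forall x y t, 0 <= t <= mdist x y ->
  exists2 z, mdist x z = t & mdist z y = mdist x y - t.

Lemma mdist_continuous x : continuous (mdist x : X -> R).
Proof.
move=> y; apply/cvgrPdist_lt => e e0.
apply/metricType_numDomainType.nbhs_mdistP; exists e => //= z /= yz.
have := metric_triangle x y z; have := metric_triangle x z y.
by rewrite (metric_sym z y) => h1 h2; rewrite ltr_norml; lra.
Qed.

Lemma open_nbhd_of delta (S : set X) : open (nbhd_of delta S).
Proof.
have -> : nbhd_of delta S = \bigcup_(y in S) (mdist y @^-1` [set r | r < delta]).
  apply/seteqP; split=> x /= [y Sy xy]; exists y => //=; first by rewrite metric_sym.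
  by rewrite metric_sym.
apply: bigcup_open => y _; apply: open_comp => [z _|]; last exact: open_lt.
exact: mdist_continuous.
Qed.

End Basics.
Arguments four_point {R} X delta.
Arguments interpolable {R} X.

Section Geodesics.
Context {R : realType} {X : metricType R}.
Implicit Types (x y z w : X) (delta t : R).

(** Subdivide at [s] and [t]. The cases arise because [itv_partition] requires strictly increasing
    points, so coinciding ones must be dropped. *)
Lemma path_length_ge2 a b (gamma : R -> X) s t : a <= s -> s <= t -> t <= b ->
  ((mdist (gamma a) (gamma s) + mdist (gamma s) (gamma t)
     + mdist (gamma t) (gamma b))%:E <= path_length a b gamma)%E.
Proof.
have sup l : itv_partition a b l -> ((\sum_(0 <= i < size l)
      mdist (gamma (nth b (a :: l) i)) (gamma (nth b (a :: l) i.+1)))%:E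
      <= path_length a b gamma)%E.
  by move=> al; apply: ereal_sup_ubound; exists l.
rewrite le_eqVlt => /orP[/eqP E|as_].
  subst s; rewrite mdistxx add0r le_eqVlt => /orP[/eqP E|at_].
    subst t; rewrite mdistxx add0r le_eqVlt => /orP[/eqP E|ab].
      subst b; apply: le_trans (sup [::] _); last by split.
      by rewrite mdistxx big_nil.
    apply: le_trans (sup [:: b] _); last by split=> //=; rewrite ab.
    by rewrite big_nat1.
  rewrite le_eqVlt => /orP[/eqP E|tb].
    subst b; apply: le_trans (sup [:: t] _); last by split=> //=; rewrite at_.
    by rewrite big_nat1 mdistxx addr0.
  apply: le_trans (sup [:: t; b] _); last by split=> //=; rewrite at_ tb.
  by rewrite big_nat_recr//= big_nat1.
rewrite le_eqVlt => /orP[/eqP E|st].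
  subst t; rewrite mdistxx addr0 le_eqVlt => /orP[/eqP E|sb].
    subst b; apply: le_trans (sup [:: s] _); last by split=> //=; rewrite as_.
    by rewrite big_nat1 mdistxx addr0.
  apply: le_trans (sup [:: s; b] _); last by split=> //=; rewrite as_ sb.
  by rewrite big_nat_recr//= big_nat1.
rewrite le_eqVlt => /orP[/eqP E|tb].
  subst b; apply: le_trans (sup [:: s; t] _); last by split=> //=; rewrite as_ st.
  by rewrite big_nat_recr//= big_nat1 mdistxx addr0.
apply: le_trans (sup [:: s; t; b] _); last by split=> //=; rewrite as_ st tb.
by rewrite !big_nat_recr//= big_geq// add0r.
Qed.

Lemma geodesic_between x y A p : is_geodesic x y A -> A p ->
  mdist x p + mdist p y = mdist x y.
Proof.
move=> [a [b [gamma [[[_ _ ga gb] _ <-] len]]]] [t /=].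
rewrite in_itv/= => /andP[at_ tb] <-.
have := path_length_ge2 gamma (lexx a) at_ tb.
rewrite len lee_fin mdistxx add0r ga gb => h.
by apply/eqP; rewrite eq_le h metric_triangle.
Qed.

Lemma geodesic_between2 x y A p q : is_geodesic x y A -> A p -> A q ->
  mdist x p + mdist p q + mdist q y = mdist x y \/
  mdist x q + mdist q p + mdist p y = mdist x y.
Proof.
move=> [a [b [gamma [[[_ _ ga gb] _ <-] len]]]] [s /= +] + [t /=].
rewrite !in_itv/= => /andP[as_ sb] <- /andP[at_ tb] <-.
have tri (u v : X) : mdist x y <= mdist x u + mdist u v + mdist v y.
  have := metric_triangle x v y; have := metric_triangle x u v; lra.
have [st|/ltW ts] := leP s t; [left|right].
  have := path_length_ge2 gamma as_ st tb.
  by rewrite len lee_fin ga gb => h; apply/eqP; rewrite eq_le h tri.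
have := path_length_ge2 gamma at_ ts sb.
by rewrite len lee_fin ga gb => h; apply/eqP; rewrite eq_le h tri.
Qed.

Lemma geodesic_ends x y A : is_geodesic x y A -> A x /\ A y.
Proof.
move=> [a [b [gamma [[[ab _ ga gb] _ <-] _]]]].
by split; [exists a|exists b] => //=; rewrite in_itv/= lexx ab.
Qed.

Lemma geodesic_connected x y A : is_geodesic x y A -> connected A.
Proof.
move=> [a [b [gamma [[[ab gc ga gb] _ <-] _]]]].
by apply: connected_continuous_connected => //; exact: segment_connected.
Qed.

(** The distance to [x] takes all intermediate values along a geodesic. *)
Lemma geodesic_interpolable : geodesic_space X -> interpolable X.
Proof.
move=> [_ geo] x y t /andP[t0 td].
have [A gA] := geo x y.
have [p Ap xp] : exists2 p, A p & mdist x p = t.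
  have [a [b [gamma [[[ab gc ga gb] _ <-] len]]]] := gA.
  have hc : {within `[a, b], continuous (mdist x \o gamma)}.
    by apply: within_continuous_comp => // z _; exact: mdist_continuous.
  have [|c cab hct] := IVT (v := t) ab hc.
    by rewrite /= ga gb mdistxx ge_min le_max t0 td orbT.
  by exists (gamma c) => //; exists c.
exists p => //; rewrite -(geodesic_between gA Ap) xp; lra.
Qed.

(* A point of the connected side [x, z] that is close to both other sides
   plays the role of the centre of a tripod. *)
Lemma thin_tripod Delta x y z A : 0 < Delta -> geodesic_space X ->
  has_thin_triangles Delta X -> is_geodesic x z A ->
  exists2 p, A p &
    mdist x p + mdist p y <= mdist x y + 2 * Delta /\
    mdist z p + mdist p y <= mdist z y + 2 * Delta.
Proof.
move=> D0 [_ geo] thin gA.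
have [B gB] := geo z y; have [C gC] := geo y x.
have [AB _ _] := thin _ _ _ _ _ _ gA gB gC.
have [Ax Az] := geodesic_ends gA; have [Bz _] := geodesic_ends gB.
have [_ Cx] := geodesic_ends gC.
have [p [Ap [v Bv pv] [u Cu pu]]] :
    exists p, [/\ A p, nbhd_of Delta B p & nbhd_of Delta C p].
  apply: contrapT => /forallNP none.
  have cA := geodesic_connected gA.
  (* If no point were close to both sides, the part of [A] near [B] would be the part not near [C],
     hence clopen in the connected [A]. It contains [z], so it would contain [x], which lies on
     [C]. *)
  have EA : A `&` nbhd_of Delta B = A `&` ~` nbhd_of Delta C.
    apply/seteqP; split=> p [Ap pp]; split=> //.
      by move=> pC; apply: (none p).
    have [q [Bq|Cq] pq] := AB _ Ap; first by exists q.
    by exfalso; apply: pp; exists q.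
  have : A `&` nbhd_of Delta B = A.
    apply: cA.
    - by exists z; split=> //; exists z => //; rewrite mdistxx.
    - by exists (nbhd_of Delta B) => //; exact: open_nbhd_of.
    - exists (~` nbhd_of Delta C); last by rewrite EA.
      exact/open_closedC/open_nbhd_of.
  rewrite EA => /seteqP[_ /(_ x Ax)[_]]; apply.
  by exists x => //; rewrite mdistxx.
exists p => //.
have := geodesic_between gB Bv; have := geodesic_between gC Cu.
have := metric_triangle z v p; have := metric_triangle p v y.
have := metric_triangle x u p; have := metric_triangle p u y.
rewrite (metric_sym v p) (metric_sym u p) (metric_sym u y) (metric_sym x u) (metric_sym y x).
lra.
Qed.

(** Take on one geodesic from [x] to [z] a centre [p] for [y] and a centre [q] for [w]. If [p] comes
    before [q], the pairing of [y] with [z] and [x] with [w] bounds the left side, otherwise the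
    other one does. Each tripod costs [2 * Delta]. *)
Lemma thin_four_point Delta : 0 < Delta -> geodesic_space X ->
  has_thin_triangles Delta X -> four_point X (4 * Delta).
Proof.
move=> D0 gX thin x y z w.
have [A gA] := gX.2 x z.
have [p Ap [xpy zpy]] := thin_tripod y D0 gX thin gA.
have [q Aq [xqw zqw]] := thin_tripod w D0 gX thin gA.
have pq := geodesic_between2 gA Ap Aq.
rewrite -lerBlDr le_max; apply/orP.
have := metric_triangle y p w; have := metric_triangle p q w.
have := metric_triangle y q w; have := metric_triangle q p y.
have := metric_sym q p; have := metric_sym q y; have := metric_sym y p.
have := metric_sym y z; have := metric_sym z p; have := metric_sym z q.
have := metric_sym z w; have := metric_sym q w; have := metric_sym p w.
have := geodesic_between gA Ap; have := geodesic_between gA Aq.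
by case: pq; [right|left]; lra.
Qed.
End Geodesics.

(** * Displacement of generators *)

Section GromovProduct.
Context {R : realType} {X : metricType R}.
Implicit Types (o x y z w : X) (c d delta : R).

(* Twice the Gromov product (x|y)_o. *)
Definition gromov o x y := mdist o x + mdist o y - mdist x y.

Lemma gromovC o x y : gromov o x y = gromov o y x.
Proof. by rewrite /gromov (addrC (mdist o x)) (metric_sym x y). Qed.

Lemma gromov_ge0 o x y : 0 <= gromov o x y.
Proof.
by have := metric_triangle x o y; rewrite /gromov (metric_sym x o); lra.
Qed.

Lemma gromov_min delta o x y z c : four_point X delta ->
  c <= gromov o x y -> c <= gromov o y z -> c - delta <= gromov o x z.
Proof.
move=> /(_ x y z o); rewrite /gromov -lerBlDr le_max.
have := metric_sym y o; have := metric_sym x o; have := metric_sym z o.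
by move=> h1 h2 h3 /orP[]; lra.
Qed.

(** Four-point inequality for [x], [f x], [f (f x)] and [f y]. As [y] is free, its displacement can
    later be replaced by the infimum. *)
Lemma four_point_translation delta (f : X -> X) x y : four_point X delta ->
  (forall u v, mdist (f u) (f v) = mdist u v) ->
  mdist x (f (f x)) <= mdist x (f x) + mdist y (f y) + delta.
Proof.
move=> /(_ x (f x) (f (f x)) (f y)) fp fd; rewrite -lerBlDr le_max in fp.
have h1 := metric_triangle (f x) (f y) y; have h2 := metric_triangle x y (f y).
rewrite !fd in fp h1; rewrite (metric_sym (f y)) in h1.
have : mdist (f (f x)) (f y) = mdist (f x) y by rewrite fd.
by case/orP: fp; lra.
Qed.

End GromovProduct.

Section Displacement.
Context {R : realType} {X : metricType R}.
Implicit Types (x y : X) (f g s t : Isom X) (delta l D : R).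

Definition translation_length (f : Isom X) : R :=
  inf [set mdist x (f x) | x in [set: X]].

Lemma translation_length_ge0 f : 0 <= translation_length f.
Proof.
rewrite /translation_length; set E := [set _ | _ in _].
have [->|/set0P E0] := eqVneq E set0; first by rewrite inf0.
by apply: lb_le_inf => // _ [x _ <-]; exact: mdist_ge0.
Qed.

Lemma translation_length_le f x : translation_length f <= mdist x (f x).
Proof.
apply: ge_inf; last by exists x.
by exists 0 => _ [y _ <-]; exact: mdist_ge0.
Qed.

Lemma mdist_square delta f x : four_point X delta ->
  mdist x (f (f x)) <= mdist x (f x) + translation_length f + delta.
Proof.
move=> fp; rewrite -lerBlDr -lerBlDl; apply: lb_le_inf.
  by exists (mdist x (f x)), x.
move=> _ [y _ <-].
by have := four_point_translation x y fp (isom_mdist f); lra.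
Qed.

Lemma isomKV f x : f (f^-1%g x) = x.
Proof. by have : (f * f^-1)%g x = x by rewrite mulgV. Qed.

Lemma isomV_mdist f x y : mdist (f^-1%g x) y = mdist x (f y).
Proof. by rewrite -[in RHS](isomKV f x) isom_mdist. Qed.

(** The product equals [2 * mdist x (f x) - mdist x (f (f x))]. So if [f] moves [x] by much more
    than its translation length, [f x] and [f^-1 x] lie in nearly the same direction from [x]. *)
Lemma gromov_square delta f x : four_point X delta ->
  mdist x (f x) - translation_length f - delta <= gromov x (f x) (f^-1%g x).
Proof.
move=> fp; have := mdist_square f x fp.
rewrite /gromov (metric_sym (f x)) isomV_mdist.
by rewrite (metric_sym x (f^-1%g x)) isomV_mdist; lra.
Qed.

(* [x] almost minimizes the maximal displacement [D]. Moving from [x] towards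
   [s x] some [t] still displaces by [D], so the directions of [s x] and [t x]
   at [x] diverge; as [s] and [t] are almost elliptic, [s^-1 * t] then
   translates by almost [2 * D]. *)
Lemma displacement_bound delta l D s t x y : 0 < delta -> four_point X delta ->
  translation_length s <= l -> translation_length t <= l ->
  translation_length (s^-1 * t)%g <= l ->
  D <= mdist x (s x) < D + delta -> mdist x (t x) < D + delta ->
  mdist x y = 3 * delta -> mdist y (s x) = mdist x (s x) - 3 * delta ->
  D <= mdist y (t y) ->
  D <= l + 20 * delta.
Proof.
move=> d0 fp sl tl stl /andP[Da aD] bD xy ysx Dty.
rewrite leNgt; apply/negP => lD.
have l0 : 0 <= l by exact: le_trans (translation_length_ge0 s) sl.
have bD' : D - 6 * delta <= mdist x (t x).
  have := metric_triangle y x (t y); have := metric_triangle x (t x) (t y).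
  by rewrite isom_mdist (metric_sym y x); lra.
pose p := s^-1%g x; pose r := t^-1%g x.
have Gs : gromov x (s x) p >= mdist x (s x) - l - delta.
  by have := gromov_square s x fp; rewrite /p; lra.
have Gt : gromov x (t x) r >= mdist x (t x) - l - delta.
  by have := gromov_square t x fp; rewrite /r; lra.
(* Otherwise [y], which lies [3 * delta] along the way to [s x], is roughly also on the way to [t x]
   and to [t^-1 x], and [t] moves it by less than [D]. The value [11 / 2] is just enough to absorb
   the losses. *)
have P : gromov x (s x) (t x) <= 11 / 2 * delta.
  rewrite leNgt; apply/negP => Pgt.
  have Gys : gromov x y (s x) = 6 * delta by rewrite /gromov ysx xy; lra.
  have Gyt : gromov x y (t x) >= 11 / 2 * delta - delta.
    by apply: (gromov_min (y := s x) fp); rewrite ?Gys; lra.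
  have Gyr : gromov x y r >= 9 / 2 * delta - delta.
    by apply: (gromov_min (y := t x) fp); lra.
  have xr : mdist x r = mdist x (t x) by rewrite metric_sym isomV_mdist.
  have yr : mdist y r = mdist x (t y) by rewrite metric_sym isomV_mdist.
  have := fp y x (t y) (t x); rewrite isom_mdist (metric_sym y x) -lerBlDr le_max.
  move: Gyr Gyt; rewrite /gromov xr yr xy => ? ? /orP[]; lra.
pose g := (s^-1 * t)%g; pose u := g x; pose v := g^-1%g x.
have uE : u = s^-1%g (t x) by [].
have vE : v = t^-1%g (s x) by rewrite /v /g invgM invgK.
have xp : mdist x p = mdist x (s x) by rewrite metric_sym isomV_mdist.
have xr : mdist x r = mdist x (t x) by rewrite metric_sym isomV_mdist.
have xu : mdist x u = mdist (s x) (t x).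
  by rewrite uE metric_sym isomV_mdist metric_sym.
have xv : mdist x v = mdist (s x) (t x) by rewrite vE metric_sym isomV_mdist.
have pu : mdist p u = mdist x (t x) by rewrite uE isom_mdist.
have rv : mdist r v = mdist x (s x) by rewrite vE isom_mdist.
have Guv := gromov_square g x fp; rewrite -/u -/v in Guv.
have Gpu : gromov x p u = 2 * mdist x (s x) - gromov x (s x) (t x).
  by rewrite /gromov xp xu pu; lra.
have Gvr : gromov x v r = 2 * mdist x (t x) - gromov x (s x) (t x).
  by rewrite /gromov xr xv (metric_sym v r) rv; lra.
have xuE : mdist x u = mdist x (s x) + mdist x (t x) - gromov x (s x) (t x).
  by rewrite xu /gromov; lra.
(* Consecutive points of the chain [s x], [p], [u], [v], [r], [t x] have large products at [x]. Four
   uses of [gromov_min], each losing [delta], carry this to [s x] and [t x], against [P]. *)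
have c1 : D - 7 * delta - l - delta <= gromov x (s x) u.
  by apply: (gromov_min (y := p) fp); lra.
have c2 : D - 8 * delta - l - delta <= gromov x (s x) v.
  apply: (gromov_min (y := u) fp); first lra.
  by move: Guv stl; rewrite /g -/u -/v; lra.
have c3 : D - 9 * delta - l - delta <= gromov x (s x) r.
  by apply: (gromov_min (y := v) fp); lra.
have : D - 10 * delta - l - delta <= gromov x (s x) (t x).
  by apply: (gromov_min (y := r) fp); first lra; rewrite gromovC; lra.
lra.
Qed.

End Displacement.

(** * A point moved little by every generator *)

Section SmallDisplacement.
Context {R : realType} {X : metricType R} {G : groupType}.
Variable rho : {multiplicative G -> Isom X}.

Lemma act1 : rho 1%g = 1%g.
Proof. by apply: (mulgI (rho 1%g)); rewrite -gmulfM !mulg1. Qed.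

Lemma actV g : rho g^-1%g = (rho g)^-1%g.
Proof. by apply: (mulgI (rho g)); rewrite -gmulfM !mulgV act1. Qed.

Lemma small_displacement delta l (S : seq G) : 0 < delta ->
  four_point X delta -> interpolable X -> [set: X] !=set0 -> 0 <= l ->
  {in S, forall s, length_function rho s <= l} ->
  {in S &, forall s t, length_function rho (s^-1 * t)%g <= l} ->
  exists x, {in S, forall s, mdist x (rho s x) <= l + 21 * delta}.
Proof.
move=> d0 fp ip [x0 _] l0 Sl SSl.
(* The condition [0 <= r] bounds [E] below even if [S] is empty. *)
pose E := [set r | 0 <= r /\ exists x, {in S, forall s, mdist x (rho s x) <= r}].
have E0 : has_inf E.
  split; last by exists 0 => r [].
  exists (\big[Num.max/0]_(s <- S) mdist x0 (rho s x0)); split.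
    exact: bigmax_ge_id.
  exists x0 => s sS.
  exact: (@le_bigmax_seq _ _ _ S 0 s xpredT (fun s => mdist x0 (rho s x0))).
(* Slightly below the infimum: if [0 <= D], every point is moved by at least [D] by some generator,
   while the near-minimizer [x] found below is moved by less than [D + delta] by all of them. *)
pose D := inf E - delta / 2.
have large y : 0 <= D -> exists2 s, s \in S & D <= mdist y (rho s y).
  move=> D0; apply: contrapT => none.
  suff : inf E <= D by rewrite /D; lra.
  apply: ge_inf; first by case: E0.
  split=> //; exists y => s sS; apply/ltW; rewrite ltNge; apply/negP => h.
  by apply: none; exists s.
have [|r [r0 [x xr]] rD] := inf_adherent (eps := delta / 2) _ E0; first lra.
exists x => s0 s0S; apply: le_trans (xr _ s0S) _.
suff : D <= l + 20 * delta by rewrite /D; lra.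
rewrite leNgt; apply/negP => lD.
have D0 : 0 <= D by lra.
have [s sS Ds] := large x D0.
have [|y xy ysx] := ip x (rho s x) (3 * delta); first lra.
have [t tS Dt] := large y D0.
have := xr s sS; have := xr t tS => xt xs.
suff : D <= l + 20 * delta by lra.
apply: (displacement_bound (s := rho s) (t := rho t) (x := x) (y := y)) => //.
- exact: Sl.
- exact: Sl.
- by have := SSl s t sS tS; rewrite /length_function gmulfM actV.
- by rewrite Ds /= /D; lra.
- by rewrite /D; lra.
Qed.

End SmallDisplacement.

(** * R-trees *)

Section Trees.
Context {R : realType} {X : metricType R}.
Implicit Types (x y z w : X) (a b : R).

Definition segm x y := [set z | mdist x z + mdist z y = mdist x y].

Lemma path_length_isometric a b (f : R -> X) : a <= b ->
  (forall u v, a <= u -> u <= v -> v <= b -> mdist (f u) (f v) = v - u) ->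
  path_length a b f = (b - a)%:E.
Proof.
move=> ab fd; apply/eqP; rewrite eq_le; apply/andP; split; last first.
  have := path_length_ge2 f (lexx a) (lexx a) ab.
  by rewrite mdistxx !add0r fd.
apply: ge_ereal_sup => _ [s abs <-]; rewrite lee_fin le_eqVlt; apply/orP; left.
apply/eqP; elim: s a {ab} abs fd => [|c s IH] a abs fd.
  by rewrite big_nil (itv_partition_nil abs) subrr.
rewrite big_nat_recl//=.
have [/andP[ac _] _] := abs.
have cs := itv_partition_cons abs.
have cb := itv_partition_le cs.
rewrite IH// => [|u v cu]; last by apply: fd; rewrite (le_trans _ cu)// ltW.
by rewrite fd// ?ltW//; lra.
Qed.

Hypothesis (fp : four_point X 0) (ip : interpolable X).

Lemma gromov_min0 o x y z c :
  c <= gromov o x y -> c <= gromov o y z -> c <= gromov o x z.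
Proof. by move=> xy yz; have := gromov_min fp xy yz; rewrite subr0. Qed.

(** The two pairings in the exact four-point inequality for [z], [x], [w], [y] give the two signs of
    the absolute value. Thus the distance to [x] is an isometric coordinate on [segm x y]. *)
Lemma segm_dist x y z w : segm x y z -> segm x y w ->
  mdist z w = `|mdist x z - mdist x w|.
Proof.
rewrite /segm /= => xzy xwy; apply/eqP; rewrite eq_le; apply/andP; split.
  have := fp z x w y; rewrite addr0 le_max (metric_sym z x) => /orP[] h.
    by rewrite ler_normr; apply/orP; left; lra.
  by rewrite ler_normr; apply/orP; right; lra.
have := metric_triangle x z w; have := metric_triangle x w z.
by rewrite (metric_sym w z) ler_norml; lra.
Qed.

(** The set is the branch at [z] towards [x]; it is open because the product is 2-Lipschitz in
    [w]. *)
Lemma open_gromov_gt0 x z : open [set w | 0 < gromov z x w].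
Proof.
rewrite openE => w /= xw; apply/metricType_numDomainType.nbhs_mdistP.
exists (gromov z x w / 2) => /= [|v /= wv]; first by rewrite divr_gt0.
have := metric_triangle z v w; have := metric_triangle x w v.
by move: xw wv; rewrite /gromov (metric_sym v w); lra.
Qed.

(** Points near some [w] other than [z] have positive product with [w]. Positivity being transitive,
    they are outside the branch when [w] is. *)
Lemma closed_gromov_gt0 x z : closed ([set w | 0 < gromov z x w] `|` [set z]).
Proof.
rewrite -openC openE => w /not_orP[/= /negP xw wz].
have zw : 0 < mdist z w.
  by rewrite mdist_gt0; apply/eqP => zw; exact/wz/esym.
apply/metricType_numDomainType.nbhs_mdistP.
exists (mdist z w) => //= v /= wv /= [xv|vz]; last first.
  by move: wv; rewrite vz metric_sym ltxx.
apply: (negP xw).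
have vw : 0 < gromov z v w.
  have := metric_triangle z v w; rewrite /gromov (metric_sym v w); lra.
have c0 : 0 < Num.min (gromov z x v) (gromov z v w) by rewrite lt_min xv.
apply: lt_le_trans c0 _.
by apply: (gromov_min0 (y := v)); rewrite ge_min lexx ?orbT.
Qed.

(* Removing [z] separates [x] from [y], since [(x|y)_z = 0]. *)
Lemma path_through_segm a b (gamma : R -> X) z : a <= b ->
  {within `[a, b], continuous gamma} -> segm (gamma a) (gamma b) z ->
  exists2 c, a <= c <= b & gamma c = z.
Proof.
move=> ab gc zs; apply: contrapT => none.
pose C := gamma @` `[a, b].
have nz w : C w -> w <> z.
  move=> [c /=]; rewrite in_itv/= => cab <- cz; apply: none.
  by exists c.
have Ca : C (gamma a) by exists a => //=; rewrite in_itv/= lexx ab.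
have Cb : C (gamma b) by exists b => //=; rewrite in_itv/= lexx ab.
have cC : connected C by exact/connected_continuous_connected/gc/segment_connected.
have CU : C `&` [set w | 0 < gromov z (gamma a) w] = C.
  apply: cC.
  - exists (gamma a); split=> //=; rewrite /gromov mdistxx subr0.
    have : 0 < mdist z (gamma a).
      by rewrite mdist_gt0; apply/eqP => /esym; exact: nz.
    lra.
  - by exists [set w | 0 < gromov z (gamma a) w] => //; exact: open_gromov_gt0.
  - exists ([set w | 0 < gromov z (gamma a) w] `|` [set z]).
      exact: closed_gromov_gt0.
    apply/seteqP; split=> w [Cw]; first by move=> ?; split=> //; left.
    by case=> // /(nz _ Cw).
move: Cb; rewrite -{1}CU => -[_ /=].
by move: zs; rewrite /segm /= /gromov (metric_sym z (gamma a)); lra.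
Qed.

(** One inclusion is [path_through_segm]. For the other, the arc visits the projection [p] of its
    point [w] to the segment both before and after [w], so injectivity gives [w = p]. *)
Lemma arc_segm x y B : is_arc x y B -> B = segm x y.
Proof.
move=> [a [b [gamma [[ab gc ga gb] inj <-]]]]; apply/seteqP; split; last first.
  move=> z; rewrite -ga -gb => /(path_through_segm ab gc)[c cab <-].
  by exists c => //=; rewrite in_itv.
move=> _ [c /= + <-]; rewrite in_itv/= => /andP[ac cb].
(* Halving the doubled product gives the distance from [x] to the branch point of the tripod [x],
   [w], [y]. *)
set w := gamma c; pose h := gromov x w y / 2.
have := metric_triangle x w y; have := metric_triangle w x y.
have := metric_triangle x y w; have := gromov_ge0 x w y.
rewrite (metric_sym w x) (metric_sym y w) => h1 h2 h3 h4.
have [|p xp py] := ip (x := x) (y := y) (t := h).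
  by move: h1; rewrite /h /gromov; lra.
have pw : mdist p w <= mdist x w - h.
  have := fp p x w y; rewrite addr0 le_max (metric_sym p x) /h /gromov.
  by move: xp py; rewrite /h /gromov => xp py /orP[]; lra.
have t1 := metric_triangle x p w; have t2 := metric_triangle w p y.
rewrite (metric_sym w p) in t2.
have [||c1 /andP[ac1 c1c] gc1] := @path_through_segm a c gamma p ac.
- apply: continuous_subspaceW gc => t /=; rewrite !in_itv/= => /andP[-> tc].
  exact: le_trans cb.
- by rewrite ga /segm /= -/w; lra.
have [||c2 /andP[cc2 c2b] gc2] := @path_through_segm c b gamma p cb.
- apply: continuous_subspaceW gc => t /=; rewrite !in_itv/= => /andP[ct ->].
  by rewrite (le_trans ac).
- rewrite gb /segm /= -/w (metric_sym w p).
  by move: pw py t2; rewrite /h /gromov; lra.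
have c12 : c1 = c2.
  apply: inj; rewrite ?in_itv/= ?ac1 ?c2b ?(le_trans c1c)// ?(le_trans ac)//.
  by rewrite gc1 gc2.
have wp : w = p.
  by rewrite /w -gc1; congr gamma; apply/eqP; rewrite eq_le c1c c12 cc2.
by rewrite wp /segm /= xp py; lra.
Qed.

Lemma segm_param x y : exists f : R -> X,
  [/\ f 0 = x, f (mdist x y) = y, f @` `[0, mdist x y] = segm x y
    & {in `[0, mdist x y] &, forall s t, mdist (f s) (f t) = `|s - t|}].
Proof.
have /choice[f fE] : forall t, exists z, 0 <= t <= mdist x y ->
    mdist x z = t /\ mdist z y = mdist x y - t.
  move=> t; have [td|td] := boolP (0 <= t <= mdist x y); last by exists x.
  by have [z xz zy] := ip td; exists z.
have d0 := mdist_ge0 x y.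
exists f; split.
- by apply/esym/mdist_positivity; have [|-> _] := fE 0; rewrite ?lexx.
- apply/mdist_positivity.
  by have [|_ ->] := fE (mdist x y); rewrite ?lexx ?d0 ?subrr.
- apply/seteqP; split=> [_ [t /= + <-]|z xzy].
    by rewrite in_itv/= => /fE[xt ty]; rewrite /segm /= xt ty; lra.
  have xz : 0 <= mdist x z <= mdist x y.
    by rewrite mdist_ge0/=; have := mdist_ge0 z y; move: xzy; rewrite /segm /=; lra.
  exists (mdist x z); first by rewrite /= in_itv.
  have [h1 h2] := fE _ xz; apply/mdist_positivity.
  rewrite (@segm_dist x y)// /segm /= h1 ?subrr ?normr0//.
  by rewrite h2; lra.
- move=> s t; rewrite !in_itv/= => /fE[h1 h2] /fE[h3 h4].
  by rewrite (@segm_dist x y) ?h1 ?h3// /segm /= ?h1 ?h2 ?h3 ?h4; lra.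
Qed.

Lemma four_point_R_tree : [set: X] !=set0 -> R_tree X.
Proof.
move=> X0.
have param x y : exists f : R -> X, [/\ is_path 0 (mdist x y) f x y,
    f @` `[0, mdist x y] = segm x y,
    {in `[0, mdist x y] &, forall s t, mdist (f s) (f t) = `|s - t|}
    & path_length 0 (mdist x y) f = (mdist x y)%:E].
  have [f [fx fy fim fd]] := segm_param x y; have d0 := mdist_ge0 x y.
  exists f; split=> //.
    split=> //; apply/subspace_continuousP => s sd.
    apply/metricType_numDomainType.cvgrPdist_lt => e e0.
    rewrite near_withinE; near=> t => td.
    rewrite fd//; near: t; exact: nbhsx_ballx.
  rewrite path_length_isometric// ?subr0// => u v u0 uv vd.
  rewrite fd ?in_itv/= ?u0 ?vd ?(le_trans uv)// ?(le_trans u0)//.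
  by rewrite distrC ger0_norm// subr_ge0.
split.
  split=> // x y; apply/eqP; rewrite eq_le; apply/andP; split.
    apply: le_ereal_inf_tmp => _ [a [b [gamma [[ab _ <- <-] ->]]]].
    by have := path_length_ge2 gamma (lexx a) (lexx a) ab; rewrite mdistxx !add0r.
  have [f [fpath _ _ <-]] := param x y.
  by apply: ereal_inf_lbound; exists 0, (mdist x y), f.
move=> x y; have [f [fpath fim fd _]] := param x y.
exists (segm x y); split; last by exists `[0, mdist x y], f.
- exists 0, (mdist x y), f; split=> // s t sI tI st.
  by have := fd s t sI tI; rewrite st mdistxx => /esym/normr0_eq0/subr0_eq.
- exact: arc_segm.
Unshelve. all: by end_near. Qed.

End Trees.

(** * Ultralimits *)

Record pmetric (R : realType) := PMetric {
  pm_sort :> Type;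
  pdist : pm_sort -> pm_sort -> R;
  pdistxx : forall x, pdist x x = 0;
  pdist_sym : forall x y, pdist x y = pdist y x;
  pdist_triangle : forall y x z, pdist x z <= pdist x y + pdist y z }.

Section MetricQuotient.
Context (R : realType) (P : pmetric R).

(** Points of the quotient are zero-distance classes taken as subsets of [P], so points at distance
    zero become equal by extensionality. *)
Definition pm_class := [set C : set P | exists x, C = [set y | pdist x y = 0]].
Definition pm_quot : Type := pm_class.
HB.instance Definition _ := gen_eqMixin pm_quot.
HB.instance Definition _ := gen_choiceMixin pm_quot.
Definition pm_pi (x : P) : pm_quot :=
  exist _ [set y | pdist x y = 0] (mem_set (ex_intro _ x erefl)).

Definition pm_repr (q : pm_quot) : P := sval (cid (set_mem (valP q))).

Lemma pm_reprK : cancel pm_repr pm_pi.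
Proof.
move=> q; apply/val_inj => /=.
by rewrite /pm_repr; case: cid => /= x ->.
Qed.

Lemma pdist_eq0 (x y z : P) : pdist x y = 0 -> pdist x z = pdist y z.
Proof.
move=> xy; apply/eqP; rewrite eq_le; apply/andP; split.
  by rewrite (le_trans (pdist_triangle y _ _))// xy add0r.
by rewrite (le_trans (pdist_triangle x _ _))// (pdist_sym y) xy add0r.
Qed.

Lemma pm_piK x : pdist x (pm_repr (pm_pi x)) = 0.
Proof.
rewrite /pm_repr; case: cid => y /= E.
suff : [set z | pdist x z = 0] y by [].
by rewrite E /= pdistxx.
Qed.

Definition qdist (p q : pm_quot) : R := pdist (pm_repr p) (pm_repr q).

Fact qdistxx p : qdist p p = 0.
Proof. exact: pdistxx. Qed.

Fact qdist_positivity p q : qdist p q = 0 -> p = q.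
Proof.
move=> pq; rewrite -(pm_reprK p) -(pm_reprK q); apply/val_inj => /=.
by apply/funext => z; rewrite /= (pdist_eq0 _ pq).
Qed.

Fact qdist_sym p q : qdist p q = qdist q p.
Proof. exact: pdist_sym. Qed.

Fact qdist_triangle q p r : qdist p r <= qdist p q + qdist q r.
Proof. exact: pdist_triangle. Qed.

HB.instance Definition _ := isMetric.Build R pm_quot
  qdistxx qdist_positivity qdist_sym qdist_triangle.

Lemma mdist_pi (x y : P) : mdist (pm_pi x) (pm_pi y) = pdist x y.
Proof.
change (qdist (pm_pi x) (pm_pi y) = pdist x y).
rewrite /qdist -(pdist_eq0 _ (pm_piK x)) pdist_sym.
by rewrite -(pdist_eq0 _ (pm_piK y)) pdist_sym.
Qed.
End MetricQuotient.

(** With [d] the displacement of [x] and [m] the midpoint of [x] and [f x], one four-point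
    inequality bounds [mdist m (f (f x))] by [d / 2 + l]; the other then bounds [mdist m (f m)] by
    [l]. *)
Lemma midpoint_displacement (R : realType) (X : metricType R) (f : Isom X) x l :
  four_point X 0 -> interpolable X -> 0 <= l ->
  mdist x (f (f x)) <= mdist x (f x) + l -> exists m, mdist m (f m) <= l.
Proof.
move=> fp ip l0 xffx; have d0 := mdist_ge0 x (f x).
have [|m xm mf] := ip x (f x) (mdist x (f x) / 2); first lra.
exists m.
have fxm : mdist (f x) (f m) = mdist x (f x) / 2 by rewrite isom_mdist.
have fmm : mdist (f m) (f (f x)) = mdist x (f x) / 2 by rewrite isom_mdist mf; lra.
have ff : mdist (f x) (f (f x)) = mdist x (f x) by rewrite isom_mdist.
have := fp m x (f (f x)) (f x); have := fp m (f x) (f m) (f (f x)).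
rewrite !addr0 !le_max (metric_sym (f (f x)) (f x)) (metric_sym m x).
by rewrite (metric_sym m (f (f x))) => /orP[?|?] /orP[?|?]; lra.
Qed.

Section UltraLimits.
Context {R : realType} {I : Type} (U : set_system I) {UU : UltraFilter U}.

Lemma ler_cvg (u v : I -> R) l m : u @ U --> l -> v @ U --> m ->
  (\forall i \near U, u i <= v i) -> l <= m.
Proof.
move=> ul vm uv; rewrite -subr_ge0; apply: (cvgr_to_ge (cvgB vm ul)).
by apply: filterS uv => i; rewrite /= subr_ge0.
Qed.

Lemma cvg_near_le (u : I -> R) l : u @ U --> l -> \forall i \near U, u i <= l + 1.
Proof.
by move=> /cvgrPdist_lt/(_ 1 ltr01); apply: filterS => i; rewrite ltr_norml; lra.
Qed.

Lemma ultra_cvgD (u v : I -> R) l m : u @ U --> l -> v @ U --> m ->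
  u i + v i @[i --> U] --> l + m.
Proof. exact: cvgD. Qed.

(** A compact segment provides a cluster point, and an ultrafilter converges to its cluster
    points. *)
Lemma bounded_ultra_cvg (u : I -> R) B : (\forall i \near U, `|u i| <= B) ->
  cvg (u @ U).
Proof.
move=> uB; have [|p [_ Up]] := @segment_compact R (- B) B (u @ U) _.
  by apply: filterS uB => i; rewrite /= in_itv/= ler_norml.
apply/cvg_ex; exists p => V Vp.
have [//|UV] := in_ultra_setVsetC (u @^-1` V) UU.
by have [z []] := Up (~` V) V UV Vp.
Qed.

Context (X : I -> metricType R) (lam : I -> R) (b : forall i, X i).
Hypothesis lam_ge0 : forall i, 0 <= lam i.

(** Between such sections the rescaled distances are bounded, hence converge along [U]. *)
Definition bounded_section (x : forall i, X i) :=
  exists B, \forall i \near U, lam i * mdist (b i) (x i) <= B.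

Definition usection := {x : forall i, X i | bounded_section x}.

Definition udist (x y : usection) : R :=
  lim (lam i * mdist (sval x i) (sval y i) @[i --> U]).

Lemma udist_cvg x y :
  lam i * mdist (sval x i) (sval y i) @[i --> U] --> udist x y.
Proof.
case: x y => [x [B xB]] [y [C yC]].
apply: (@bounded_ultra_cvg _ (B + C)) => /=; near=> i.
rewrite ger0_norm ?mulr_ge0 ?mdist_ge0//.
have h : mdist (x i) (y i) <= mdist (b i) (x i) + mdist (b i) (y i).
  by rewrite (metric_sym (b i) (x i)) metric_triangle.
apply: le_trans (ler_wpM2l (lam_ge0 i) h) _; rewrite mulrDr lerD//.
  by near: i.
by near: i.
Unshelve. all: by end_near. Qed.

Arguments udist_cvg x y : clear implicits.

Lemma udist_lim x y l :
  lam i * mdist (sval x i) (sval y i) @[i --> U] --> l -> udist x y = l.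
Proof. by move=> xy; apply: (cvg_unique (@Rhausdorff R)) xy; exact: udist_cvg. Qed.

Lemma udistxx x : udist x x = 0.
Proof.
apply: udist_lim; apply: cvg_near_cst; near=> i.
by rewrite /= mdistxx mulr0.
Unshelve. all: by end_near. Qed.

Lemma udist_sym x y : udist x y = udist y x.
Proof.
apply: udist_lim; under eq_fun do rewrite metric_sym.
exact: udist_cvg.
Qed.

Lemma udist_triangle y x z : udist x z <= udist x y + udist y z.
Proof.
apply: (ler_cvg (udist_cvg x z) (ultra_cvgD (udist_cvg x y) (udist_cvg y z))).
by apply: nearW => i /=; rewrite -mulrDr ler_wpM2l// metric_triangle.
Qed.

Definition ultralimit := PMetric udistxx udist_sym udist_triangle.

Lemma ultralimit_four_point delta : (forall i, four_point (X i) delta) ->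
  lam @ U --> 0 -> four_point (pm_quot ultralimit) 0.
Proof.
move=> fp lam0 p q r s.
rewrite -(pm_reprK p) -(pm_reprK q) -(pm_reprK r) -(pm_reprK s) !mdist_pi addr0.
move: (pm_repr p) (pm_repr q) (pm_repr r) (pm_repr s) => {p q r s} x y z w /=.
have D0 : lam i * delta @[i --> U] --> 0.
  by rewrite -(mul0r delta); apply: cvgM => //; exact: cvg_cst.
have xzyw := ultra_cvgD (udist_cvg x z) (udist_cvg y w).
have xyzw := ultra_cvgD (ultra_cvgD (udist_cvg x y) (udist_cvg z w)) D0.
have yzxw := ultra_cvgD (ultra_cvgD (udist_cvg y z) (udist_cvg x w)) D0.
rewrite addr0 in xyzw; rewrite addr0 in yzxw.
rewrite le_max; apply/orP.
(* The ultrafilter decides which pairing serves for almost all indices; the error [lam i * delta]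
   vanishes in the limit. *)
have [h|h] := in_ultra_setVsetC [set i |
    mdist (sval x i) (sval z i) + mdist (sval y i) (sval w i) <=
    mdist (sval x i) (sval y i) + mdist (sval z i) (sval w i) + delta] UU.
  left; apply: (ler_cvg xzyw xyzw); apply: filterS h => i /= h.
  by rewrite -!mulrDr ler_wpM2l.
right; apply: (ler_cvg xzyw yzxw); apply: filterS h => i /= /negP.
rewrite -ltNge => h; rewrite -!mulrDr ler_wpM2l//.
have := fp i (sval x i) (sval y i) (sval z i) (sval w i).
by rewrite -lerBlDr le_max => /orP[]; lra.
Qed.

Lemma bounded_section_near (x y : forall i, X i) (B : R) : bounded_section x ->
  (\forall i \near U, lam i * mdist (x i) (y i) <= B) -> bounded_section y.
Proof.
move=> [C xC] xyB; exists (C + B); near=> i.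
apply: le_trans (ler_wpM2l (lam_ge0 i) (metric_triangle _ (x i) _)) _.
by rewrite mulrDr lerD//; near: i.
Unshelve. all: by end_near. Qed.

Lemma cvg_udist_bounded (x y : usection) :
  \forall i \near U, lam i * mdist (sval x i) (sval y i) <= udist x y + 1.
Proof. exact: cvg_near_le (udist_cvg x y). Qed.

Lemma ultralimit_interpolable : (forall i, interpolable (X i)) ->
  interpolable (pm_quot ultralimit).
Proof.
move=> ip p q t; rewrite -(pm_reprK p) -(pm_reprK q) !mdist_pi.
move: (pm_repr p) (pm_repr q) => {p q} x y /= /andP[t0 td].
have [d0|d0] := eqVneq (udist x y) 0.
  have -> : t = 0 by apply/eqP; rewrite eq_le t0 -d0 td.
  by exists (pm_pi x); rewrite mdist_pi/= ?subr0 ?udistxx.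
have dp : 0 < udist x y by rewrite lt_neqAle eq_sym d0 (le_trans t0).
(* Distances in the factors only converge to the limit distance, so each factor is interpolated at
   the same ratio rather than at distance [t]. *)
pose th := t / udist x y.
have th01 : 0 <= th <= 1 by rewrite /th (divr_ge0 t0 (ltW dp)) ler_pdivrMr// mul1r.
have ex i : exists z, mdist (sval x i) z = th * mdist (sval x i) (sval y i)
    /\ mdist z (sval y i) = (1 - th) * mdist (sval x i) (sval y i).
  have [|z xz zy] := ip i (sval x i) (sval y i) (th * mdist (sval x i) (sval y i)).
    by case/andP: th01 => h0 h1; rewrite mulr_ge0 ?mdist_ge0//= ler_piMl// mdist_ge0.
  by exists z; rewrite xz zy mulrBl mul1r.
pose z i := sval (cid (ex i)); have zE i := svalP (cid (ex i)).
rewrite -/(z _) in zE.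
have zb : bounded_section z.
  apply: (@bounded_section_near (sval x) _ (udist x y + 1)); first exact: (svalP x).
  have := cvg_udist_bounded x y; apply: filterS => i; apply: le_trans.
  rewrite (zE i).1 ler_wpM2l// ler_piMl ?mdist_ge0//.
  by case/andP: th01.
exists (pm_pi (exist _ z zb : ultralimit)); rewrite mdist_pi; apply: udist_lim => /=.
  have -> : t = th * udist x y by rewrite /th mulfVK.
  under eq_fun do rewrite (zE _).1 mulrCA.
  by apply: cvgM; [exact: cvg_cst|exact: udist_cvg].
have -> : udist x y - t = (1 - th) * udist x y by rewrite mulrBl mul1r /th mulfVK.
under eq_fun do rewrite (zE _).2 mulrCA.
by apply: cvgM; [exact: cvg_cst|exact: udist_cvg].
Qed.

Lemma bounded_section_base : bounded_section b.
Proof. by exists 0; apply: nearW => i; rewrite mdistxx mulr0. Qed.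

Lemma ultralimit_nonempty : [set: pm_quot ultralimit] !=set0.
Proof. by exists (pm_pi (exist _ b bounded_section_base : ultralimit)). Qed.

Context {G : groupType} (rho : forall i, {multiplicative G -> Isom (X i)}).
Hypothesis bounded_orbit : forall g, bounded_section (fun i => rho i g (b i)).

Lemma bounded_section_act g (x : usection) :
  bounded_section (fun i => rho i g (sval x i)).
Proof.
have [B xB] := svalP x.
apply: (@bounded_section_near (fun i => rho i g (b i)) _ B) => //.
by apply: filterS xB => i; rewrite isom_mdist.
Qed.

Definition uact g (x : ultralimit) : ultralimit :=
  exist _ _ (bounded_section_act g x).

Lemma uact_dist g x y : udist (uact g x) (uact g y) = udist x y.
Proof.
apply: udist_lim => /=; under eq_fun do rewrite isom_mdist.
exact: udist_cvg.
Qed.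

Lemma uact_mul g h x : udist (uact (g * h)%g x) (uact g (uact h x)) = 0.
Proof.
apply: udist_lim; apply: cvg_near_cst; apply: nearW => i /=.
by rewrite gmulfM /= mdistxx mulr0.
Qed.

Lemma uact_mulV g x : udist (uact g (uact g^-1%g x)) x = 0.
Proof.
apply: udist_lim; apply: cvg_near_cst; apply: nearW => i /=.
by rewrite actV isomKV mdistxx mulr0.
Qed.

Definition qact g (q : pm_quot ultralimit) : pm_quot ultralimit :=
  pm_pi (uact g (pm_repr q)).

Lemma pm_pi_eq (x y : ultralimit) : udist x y = 0 -> pm_pi x = pm_pi y.
Proof. by move=> xy; apply/mdist_positivity; rewrite mdist_pi. Qed.

Lemma qact_pi g x : qact g (pm_pi x) = pm_pi (uact g x).
Proof.
by apply: pm_pi_eq; rewrite uact_dist udist_sym; exact: (pm_piK x).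
Qed.

Lemma qact_mdist g p q : mdist (qact g p) (qact g q) = mdist p q.
Proof.
by rewrite -(pm_reprK p) -(pm_reprK q) !qact_pi !mdist_pi; exact: uact_dist.
Qed.

Lemma qact_surj g q : exists p, qact g p = q.
Proof.
exists (pm_pi (uact g^-1%g (pm_repr q))); rewrite qact_pi -[RHS]pm_reprK.
exact/pm_pi_eq/uact_mulV.
Qed.

Definition qact_isom g : Isom (pm_quot ultralimit) :=
  MkIsom (qact_mdist g) (qact_surj g).

Lemma qact_isomM : {morph qact_isom : g h / (g * h)%g}.
Proof.
move=> g h; apply: isomP => q /=.
by rewrite -(pm_reprK q) !qact_pi; exact/pm_pi_eq/uact_mul.
Qed.

HB.instance Definition _ :=
  isMultiplicative.Build G (Isom (pm_quot ultralimit)) qact_isom qact_isomM.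

(** Displacements in the limit are limits of displacements, which are at least the lengths.
    Conversely [mdist_square] at the base points loses its error in the limit, and
    [midpoint_displacement] gives a point moved by at most [l]. *)
Lemma ultralimit_length_function delta g l : lam @ U --> 0 ->
  (forall i, four_point (X i) delta) -> (forall i, interpolable (X i)) ->
  lam i * length_function (rho i) g @[i --> U] --> l ->
  length_function qact_isom g = l.
Proof.
move=> lam0 fp ip gl; pose x : ultralimit := exist _ b bounded_section_base.
apply/eqP; rewrite eq_le; apply/andP; split; last first.
  apply: lb_le_inf.
    by exists (mdist (pm_pi x) (qact_isom g (pm_pi x))), (pm_pi x).
  move=> _ [q _ <-]; rewrite -(pm_reprK q) /= qact_pi mdist_pi /=.
  apply: ler_cvg gl (udist_cvg _ _) _; apply: nearW => i /=.
  by rewrite ler_wpM2l//; exact: (translation_length_le (rho i g)).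
have l0 : 0 <= l.
  apply: cvgr_to_ge gl _; apply: nearW => i.
  by rewrite mulr_ge0//; exact: (translation_length_ge0 (rho i g)).
have [|m mg] := midpoint_displacement (f := qact_isom g) (x := pm_pi x)
    (ultralimit_four_point fp lam0) (ultralimit_interpolable ip) l0.
  rewrite /= !qact_pi !mdist_pi /=.
  have D0 : lam i * delta @[i --> U] --> 0.
    by rewrite -(mul0r delta); apply: cvgM => //; exact: cvg_cst.
  have h := ultra_cvgD (ultra_cvgD (udist_cvg x (uact g x)) gl) D0.
  rewrite addr0 in h.
  apply: ler_cvg (udist_cvg _ _) h _; apply: nearW => i /=.
  by rewrite -!mulrDr ler_wpM2l//; exact: (mdist_square (rho i g) _ (fp i)).
exact: le_trans (translation_length_le (qact_isom g) m) mg.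
Qed.

End UltraLimits.

(** * A compact set of length functions *)

Section WordLength.
Context {R : realType} {G : groupType}.

(** [n g] bounds the word length of [g], expressed without words through subadditive symmetric
    functions. The ones used are displacements of a fixed point. *)
Definition word_growth (S : seq G) (n : G -> nat) := forall f : G -> R,
  f 1%g = 0 -> (forall g h, f (g * h)%g <= f g + f h) ->
  (forall g, f g^-1%g = f g) -> forall B, 0 <= B ->
  {in S, forall s, f s <= B} -> forall g, f g <= (n g)%:R * B.

(** The elements admitting a bound form a subgroup containing [S]. *)
Lemma finitely_generated_word_growth : finitely_generated G ->
  exists S n, word_growth S n.
Proof.
move=> [S gen]; exists S.
pose bnd g n := forall f : G -> R, f 1%g = 0 ->
  (forall g h, f (g * h)%g <= f g + f h) -> (forall g, f g^-1%g = f g) ->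
  forall B, 0 <= B -> {in S, forall s, f s <= B} -> f g <= n%:R * B.
pose H : {pred G} := fun g => `[< exists n, bnd g n >].
have /choice[n nP] : forall g, exists n, bnd g n.
  move=> g; apply/asboolP; have : g \in H; last by [].
  apply: gen => [|s sS]; last first.
    by apply/asboolP; exists 1 => f f1 fM fV B B0 /(_ s sS); rewrite mul1r.
  split; first by apply/asboolP; exists 0 => f f1 _ _ B _ _; rewrite f1 mul0r.
  move=> u v /asboolP[m um] /asboolP[p vp]; apply/asboolP.
  exists (m + p)%N => f f1 fM fV B B0 fS.
  rewrite natrD mulrDl (le_trans (fM u v^-1%g))// lerD ?fV//; first exact: um.
  exact: vp.
by exists n => f f1 fM fV B B0 fS g; exact: nP.
Qed.

Lemma orbit_bound (X : metricType R) (rho : {multiplicative G -> Isom X})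
    (S : seq G) (n : G -> nat) b B :
  word_growth S n -> 0 <= B -> {in S, forall s, mdist b (rho s b) <= B} ->
  forall g, mdist b (rho g b) <= (n g)%:R * B.
Proof.
move=> nP B0 bS g.
apply: (nP (fun g => mdist b (rho g b))) => //.
- by rewrite act1 mdistxx.
- move=> h k; apply: le_trans (metric_triangle _ (rho h b) _) _.
  by rewrite lerD2l gmulfM isom_mdist.
- by move=> h; rewrite actV metric_sym isomV_mdist.
Qed.

End WordLength.
Arguments finitely_generated_word_growth R {G}.

Lemma cvg_sumr {R : realType} {T J : Type} (F : set_system T) {FF : Filter F}
    (r : seq J) (u : J -> T -> R) (l : J -> R) :
  (forall j, u j @ F --> l j) ->
  \sum_(j <- r) u j t @[t --> F] --> \sum_(j <- r) l j.
Proof.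
move=> ul; elim: r => [|j r IH].
  by rewrite big_nil; under eq_fun do rewrite big_nil; exact: cvg_cst.
rewrite big_cons; under eq_fun do rewrite big_cons.
exact: cvgD.
Qed.

(** * Compactness from a slice of a cone *)

Section Compactness.
Context {R : realType} {G : groupType} (F : seq G) (k : G -> R).
Hypothesis k_ge0 : forall g, 0 <= k g.
Implicit Types (v : LF R G * R) (L : LF R G) (q : PLF R G) (p : LFbar R G).

(** A homogeneous gauge: on [tame_cone] these finitely many terms control every coordinate. *)
Definition weight v : R := `|v.2| + \sum_(f <- F) `|v.1 f|.

Definition scale (c : R) v : LF R G * R := ((fun g => c * v.1 g), c * v.2).

Definition tame_cone : set (LF R G * R) :=
  [set v | forall g, `|v.1 g| <= k g * weight v].

Definition tame : set (LFbar R G) := [set p | match p with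
  | inl L => tame_cone (L, 1)
  | inr q => exists2 L, projectivizes_to L q & tame_cone (L, 0)
  end].

Lemma weight_ge0 v : 0 <= weight v.
Proof. by rewrite addr_ge0// sumr_ge0. Qed.

Lemma weight_scale c v : weight (scale c v) = `|c| * weight v.
Proof.
rewrite /weight /= normrM mulrDr mulr_sumr; congr (_ + _).
by apply: eq_bigr => f _; rewrite normrM.
Qed.

Lemma tame_cone_scale c v : tame_cone v -> tame_cone (scale c v).
Proof.
move=> vt g; rewrite weight_scale /= normrM mulrCA.
by rewrite ler_wpM2l.
Qed.

Lemma projectivizes_to_scale c L q : c != 0 -> projectivizes_to L q ->
  projectivizes_to (fun g => c * L g) q.
Proof.
move=> c0 [M ML <-].
have Lc : (fun g => c * L g) <> @LF0 R G.
  move=> /funeqP Lc; have /set_mem := valP M; apply.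
  rewrite -set_valE ML; apply/funext => g.
  by apply/eqP; have /eqP := Lc g; rewrite mulf_eq0 (negbTE c0).
pose N : LF_nz R G :=
  exist _ (fun g => c * L g) (mem_set (Lc : [set L : LF R G | L <> @LF0 R G] _)).
exists N => //; apply/esym/eqmodP/asboolP.
by exists c => // g; rewrite ML.
Qed.

Lemma projectivizes_to_eq L M q : projectivizes_to L q -> projectivizes_to M q ->
  exists2 c, c != 0 & M = (fun g => c * L g).
Proof.
move=> [L' <- <-] [M' <-] /esym/eqmodP/asboolP[c c0 E].
by exists c => //; apply/funext => g; exact: E.
Qed.

Lemma projectivizes_to_neq0 L q : projectivizes_to L q -> L <> @LF0 R G.
Proof. by move=> [M <- _]; have /set_mem := valP M. Qed.

Lemma projectivizes_to_ex L : L <> @LF0 R G -> exists q, projectivizes_to L q.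
Proof.
move=> L0; pose M : LF_nz R G :=
  exist _ L (mem_set (L0 : [set L : LF R G | L <> @LF0 R G] L)).
by exists (projectivize M), M.
Qed.

Lemma eval_fst_cvg g v : w.1 g @[w --> v] --> v.1 g.
Proof.
exact: (cvg_comp fst (fun M : LF R G => M g) cvg_fst (@LF_eval_cont R G g v.1)).
Qed.

Lemma weight_cvg v : weight w @[w --> v] --> weight v.
Proof.
have h1 : `|w.2| @[w --> v] --> `|v.2|.
  by apply: (@cvg_norm R R^o _ (nbhs v) _ (fun w : LF R G * R => w.2)); exact: cvg_snd.
have h2 : \sum_(f <- F) `|w.1 f| @[w --> v] --> \sum_(f <- F) `|v.1 f|.
  apply: (@cvg_sumr R _ _ (nbhs v) _ F (fun f (w : LF R G * R) => `|w.1 f|)) => f.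
  exact: (@cvg_norm R R^o _ (nbhs v) _ (fun w : LF R G * R => w.1 f) _ (@eval_fst_cvg f v)).
exact: (@cvgD R R^o _ (nbhs v) _ _ _ _ _ h1 h2).
Qed.

Lemma closed_tame_cone : closed tame_cone.
Proof.
have -> : tame_cone = \bigcap_g [set v | k g * weight v - `|v.1 g| >= 0].
  apply/seteqP; split=> v vt g.
    by move=> _ /=; rewrite subr_ge0.
  by rewrite -subr_ge0; exact: vt.
apply: closed_bigI => g _.
apply: (@preimage_closed _ _ (fun v => k g * weight v - `|v.1 g|) [set x : R | 0 <= x]).
  move=> v _; rewrite /continuous_at.
  have h1 : k g * weight w @[w --> v] --> k g * weight v.
    exact: (@cvgM R _ (nbhs v) _ _ _ _ _ (@cvg_cst _ (k g) _ (nbhs v) _) (@weight_cvg v)).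
  have h2 : `|w.1 g| @[w --> v] --> `|v.1 g|.
    exact: (@cvg_norm R R^o _ (nbhs v) _ (fun w : LF R G * R => w.1 g) _ (@eval_fst_cvg g v)).
  exact: (@cvgB R R^o _ (nbhs v) _ _ _ _ _ h1 h2).
exact: closed_ge.
Qed.

Lemma tame_cone0 : tame_cone (@LF0 R G, 0).
Proof. by move=> g; rewrite normr0 mulr_ge0// weight_ge0. Qed.

(** Scale invariance of [tame_cone] settles this off the origin. The origin is on neither side: it
    lies in [tame_cone] and in no [LFbar_cone]. *)
Lemma LFbar_cone_tameC : LFbar_cone (~` tame) = ~` tame_cone.
Proof.
apply/seteqP; split=> -[L t] /=.
  move=> [[/= t0 nt]|[/= -> [q Lq nt]]] vt; apply: nt.
    have := tame_cone_scale t^-1 vt; rewrite /scale/= mulVf//.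
    by under eq_fun do rewrite mulrC.
  by exists L.
move=> nt; have [t0|t0] := eqVneq t 0; [right|left]; split=> //=.
  have [L0|q Lq] := @projectivizes_to_ex L.
    by apply: nt; rewrite t0 L0; exact: tame_cone0.
  exists q => // -[M Mq Mt]; apply: nt.
  have [c c0 ->] := projectivizes_to_eq Mq Lq.
  by have := tame_cone_scale c Mt; rewrite /scale /= mulr0 t0.
move=> vt; apply: nt; have := tame_cone_scale t vt; rewrite /scale /= mulr1.
by under eq_fun do rewrite mulrC mulfVK//.
Qed.

Lemma closed_tame : closed tame.
Proof.
rewrite -openC.
change (open (LFbar_cone (~` tame))).
by rewrite LFbar_cone_tameC; apply/closed_openC/closed_tame_cone.
Qed.

Definition unit_tame_cone := tame_cone `&` [set v | weight v = 1].

(** On the slice the coordinate at [g] is bounded by [k g] and the real one by [1], so Tychonoff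
    applies. *)
Lemma compact_unit_tame_cone : compact unit_tame_cone.
Proof.
pose box := [set L : LF R G | forall g, `[- k g, k g]%classic (L g)] `*`
            `[- 1, 1 : R]%classic.
apply: (@subclosed_compact _ _ box).
- apply: closedI; first exact: closed_tame_cone.
  apply: (@preimage_closed _ _ weight [set 1 : R]) => [v _|]; first exact: weight_cvg.
  exact/accessible_closed_set1/hausdorff_accessible/Rhausdorff.
- apply: compact_setX; last exact: segment_compact.
  apply: (@tychonoff G (fun=> R) (fun g => `[- k g, k g]%classic)) => g.
  exact: segment_compact.
- move=> v [vt /= v1]; split=> /= [g|]; rewrite /= in_itv/= -ler_norml.
    by have := vt g; rewrite v1 mulr1.
  by rewrite -v1 lerDl sumr_ge0.
Qed.

Lemma unit_tame_cone_neq0 v : unit_tame_cone v -> ~ (v.1 = @LF0 R G /\ v.2 = 0).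
Proof.
move=> [_ /= v1] [L0 t0]; move: v1; rewrite /weight L0 t0 normr0 add0r big1//.
by move=> /esym/eqP; rewrite oner_eq0.
Qed.

Lemma tame_weight_gt0 v : tame_cone v -> v.1 <> @LF0 R G \/ v.2 <> 0 -> 0 < weight v.
Proof.
move=> vt v0; rewrite lt_neqAle weight_ge0 andbT; apply/negP => /eqP w0.
case: v0; apply.
  apply/funext => g; apply/eqP; rewrite -normr_eq0 eq_le normr_ge0 andbT.
  by have := vt g; rewrite -w0 mulr0.
apply/eqP; rewrite -normr_eq0 eq_le normr_ge0 andbT.
by rewrite [leRHS]w0 lerDl sumr_ge0.
Qed.

(** The projection from the cone is continuous off the origin, and the image of the compact slice of
    weight one covers [tame]: divide any representative by its weight. *)
Lemma compact_tame : compact tame.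
Proof.
(* [p] is the class of [v]; the third case leaves the value at the origin arbitrary, to make the
   projection total. *)
pose cls v p := [\/ v.2 != 0 /\ p = inl (fun g => v.1 g / v.2),
  v.2 = 0 /\ exists2 q, projectivizes_to v.1 q & p = inr q |
  v.1 = @LF0 R G /\ v.2 = 0].
have /choice[pi piP] : forall v, exists p, cls v p.
  move=> v; have [t0|t0] := eqVneq v.2 0; last first.
    by exists (inl (fun g => v.1 g / v.2)); apply: Or31.
  have [L0|/projectivizes_to_ex[q vq]] := pselect (v.1 = @LF0 R G).
    by exists (inl (@LF0 R G)); apply: Or33.
  by exists (inr q); apply: Or32; split=> //; exists q.
(* Off the origin [LFbar_cone V] is the preimage of [V] under [pi], which is the continuity needed
   below. *)
have piE v V : ~ (v.1 = @LF0 R G /\ v.2 = 0) -> LFbar_cone V v <-> V (pi v).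
  move=> v0; have [[t0 ->]|[t0 [q vq ->]]|//] := piP v.
    split=> [[[]//|[/eqP]]|Vv]; first by rewrite (negbTE t0).
    by left.
  split=> [[[/negP[]]|[_ [q' vq' Vq']]]|Vq]; first exact/eqP.
    by rewrite (projectivizes_to_fun vq vq').
  by right; split=> //; exists q.
apply: (@subclosed_compact _ _ (pi @` unit_tame_cone)).
- exact: closed_tame.
- apply: continuous_compact; last exact: compact_unit_tame_cone.
  apply/subspace_continuousP => v vQ W.
  rewrite /= nbhsE => -[V [oV Vv] VW].
  have oc : open (LFbar_cone V) by exact: oV.
  have nV : nbhs v (LFbar_cone V).
    by apply: open_nbhs_nbhs; split=> //; apply/piE => //; exact: unit_tame_cone_neq0.
  rewrite /= nbhs_filterE /within/=; apply: filterS nV => w Vw wQ; apply: VW.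
  by apply/piE => //; exact: unit_tame_cone_neq0.
- have unit v : tame_cone v -> 0 < weight v -> unit_tame_cone (scale (weight v)^-1 v).
    move=> vt v0; split; first exact: tame_cone_scale.
    by rewrite /= weight_scale gtr0_norm ?invr_gt0// mulVf// gt_eqF.
  move=> [L|q] /=.
    move=> Lt; have L0 : 0 < weight (L, 1).
      by apply: tame_weight_gt0 => //; right; exact/eqP/oner_neq0.
    set w := weight _ in L0.
    exists (scale w^-1 (L, 1)); first exact: unit.
    have w0 : w^-1 != 0 by rewrite invr_neq0// gt_eqF.
    have [[_ ->]|[/= /eqP]|[_ /= /eqP]] := piP (scale w^-1 (L, 1)).
    + congr inl; apply/funext => g /=; rewrite mulr1 mulrAC divff// mul1r//.
    + by rewrite mulr1 (negbTE w0).
    + by rewrite mulr1 (negbTE w0).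
  move=> [L Lq Lt]; have L0 : 0 < weight (L, 0).
    by apply: tame_weight_gt0 => //; left; exact: projectivizes_to_neq0 Lq.
  set w := weight _ in L0.
  have w0 : w^-1 != 0 by rewrite invr_neq0// gt_eqF.
  exists (scale w^-1 (L, 0)); first exact: unit.
  have wq := projectivizes_to_scale w0 Lq.
  have [[/= ]|[_ [q' wq' ->]]|[/= wL0 _]] := piP (scale w^-1 (L, 0)).
  + by rewrite mulr0 eqxx.
  + by congr inr; exact: projectivizes_to_fun wq' wq.
  + by have := projectivizes_to_neq0 wq.
Qed.

End Compactness.

(** * Limits of actions on spaces with thin triangles *)

Lemma PLF_representative (R : realType) (G : groupType) (p : PLF R G) :
  exists M, projectivizes_to M p.
Proof. by exists (set_val (repr p)), (repr p) => //; exact: reprK. Qed.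

(** Bundled so that one use of choice picks space, action and base point for every index. *)
Record based_action (R : realType) (G : groupType) := BasedAction {
  ba_space : metricType R;
  ba_act : {multiplicative G -> Isom ba_space};
  ba_base : ba_space }.

Section LengthFunctionsOfThinActions.
Context {R : realType} {G : groupType} (Delta : R) (S : seq G) (n : G -> nat).
Hypothesis Delta_gt0 : 0 < Delta.
Hypothesis nP : @word_growth R G S n.

Definition test_words : seq G := S ++ [seq (s^-1 * t)%g | s <- S, t <- S].

(** The sum dominates the length of each test word; [84 * Delta] is [21] times the four-point error
    [4 * Delta]. *)
Definition growth (L : LF R G) : R :=
  \sum_(f <- test_words) `|L f| + 84 * Delta.

Lemma thin_orbit_bound (X : metricType R) (rho : {multiplicative G -> Isom X}) :
  geodesic_space X -> has_thin_triangles Delta X ->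
  exists b, forall g, mdist b (rho g b) <= (n g)%:R * growth (length_function rho).
Proof.
move=> gX thin; set l := \sum_(f <- test_words) `|length_function rho f|.
have l0 : 0 <= l by rewrite sumr_ge0.
have le_l f : f \in test_words -> length_function rho f <= l.
  move=> fF; rewrite /l (big_rem f)//=; apply: le_trans (ler_norm _) _.
  by rewrite lerDl sumr_ge0.
have d0 : 0 < 4 * Delta by rewrite mulr_gt0.
have [|s t sS tS|b bS] := small_displacement d0 (thin_four_point Delta_gt0 gX thin)
    (geodesic_interpolable gX) gX.1.1 l0 (rho := rho) (S := S).
- by move=> s sS; apply: le_l; rewrite mem_cat sS.
- by apply: le_l; rewrite mem_cat; apply/orP; right; apply/allpairsP; exists (s, t).
exists b; apply: (orbit_bound nP).
  by rewrite /growth addr_ge0// mulr_ge0// ltW.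
move=> s sS; apply: le_trans (bS _ sS) _.
by rewrite /growth -/l mulrA lerD2l; lra.
Qed.

(** With [l] the sum over the test words, [(L, 1)] has weight [1 + l], and [l + 84 * Delta <= (1 +
    84 * Delta) * (1 + l)] makes the orbit bound homogeneous. *)
Lemma thin_tame_cone L : length_functions_thin G Delta L ->
  tame_cone test_words (fun g => (n g)%:R * (1 + 84 * Delta)) (L, 1).
Proof.
move=> [X [rho [gX thin ->]]] g /=.
have [b bP] := thin_orbit_bound rho gX thin.
rewrite ger0_norm; last exact: (translation_length_ge0 (rho g)).
apply: le_trans (translation_length_le (rho g) b) (le_trans (bP g) _).
rewrite -mulrA ler_wpM2l// /growth /weight /= normr1.
set l := \sum_(f <- _) _; have l0 : 0 <= l by rewrite sumr_ge0.
have := mulr_ge0 (ltW Delta_gt0) l0; lra.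
Qed.

Lemma thin_limit_tree p :
  closure [set (inl L : LFbar R G) | L in length_functions_thin G Delta] (inr p) ->
  exists (T : metricType R) (rho : {multiplicative G -> Isom T}),
    R_tree T /\ projectivizes_to (length_function rho) p.
Proof.
set A := [set _ | _ in _] => Ap.
(* The ultrafilter lives on [LFbar] itself, whose points index the ultralimit. *)
have [U [UU AU]] := ultraFilterLemma (within_nbhs_proper Ap).
have UA : U A by apply: AU; rewrite /within /=; exact: nearW.
have Up : U --> (inr p : LFbar R G).
  by move=> V pV; apply: AU; rewrite /within/=; apply: filterS pV.
(* [L0] supplies a default space for the indices outside [A]. *)
have [q0 [L0 L0thin _]] : A !=set0 by case: (filter_ex UA) => q ?; exists q.
have /choice[a aP] : forall q : LFbar R G, exists a : based_action R G,
    [/\ geodesic_space (ba_space a), has_thin_triangles Delta (ba_space a),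
      forall g, mdist (ba_base a) (ba_act a g (ba_base a)) <=
        (n g)%:R * growth (length_function (ba_act a))
    & A q -> q = inl (length_function (ba_act a))].
  move=> q; have [L Lthin Lq] : exists2 L, length_functions_thin G Delta L &
      A q -> q = inl L.
    have [[L Lthin <-]|nAq] := pselect (A q); first by exists L.
    by exists L0.
  have [X [rho [gX thin LE]]] := Lthin.
  have [b bP] := thin_orbit_bound rho gX thin.
  by exists (BasedAction rho b); split=> //= /Lq ->; rewrite LE.
pose f q := length_function (ba_act (a q)).
have fU : (inl (f q) : LFbar R G) @[q --> U] --> (inr p : LFbar R G).
  apply: cvg_trans Up; apply: near_eq_cvg; apply: filterS UA => q Aq.
  by have [_ _ _ /(_ Aq)] := aP q.
have [M Mp] := PLF_representative p.
have [lam [lam0 lamf]] := (cvg_LFbarP _ f Mp).1 fU.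
(* Classes in [PLF] allow negative factors, so [lam] may change sign. The ultrafilter fixes the sign
   almost everywhere, and passing to absolute values multiplies the limit by [1] or [-1], which
   keeps its class. *)
have [c c0 cM] : exists2 c : R, c != 0 &
    forall g, `|lam q| * f q g @[q --> U] --> c * M g.
  have lamg g : lam q * f q g @[q --> U] --> M g.
    exact: (LF_cvgP _ (fun q g => lam q * f q g) M).1 lamf g.
  have [h|h] := in_ultra_setVsetC [set q | 0 <= lam q] UU.
    exists 1 => [|g]; rewrite ?oner_eq0// mul1r; apply: cvg_trans (lamg g).
    by apply: near_eq_cvg; apply: filterS h => q /= lq; rewrite ger0_norm.
  exists (-1) => [|g]; rewrite ?oppr_eq0 ?oner_eq0// mulN1r.
  apply: cvg_trans (cvgN (lamg g)); apply: near_eq_cvg.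
  apply: filterS h => q /= /negP; by rewrite -ltNge => lq; rewrite ltr0_norm// mulNr.
have nlam0 : `|lam q| @[q --> U] --> 0 by rewrite -(normr0 R); exact: cvg_norm.
have lam_ge0 q : 0 <= `|lam q| by [].
have d0 : 0 < 4 * Delta by rewrite mulr_gt0.
have fp q : four_point (ba_space (a q)) (4 * Delta).
  by have [gX thin _ _] := aP q; exact: thin_four_point.
have ip q : interpolable (ba_space (a q)).
  by have [gX _ _ _] := aP q; exact: geodesic_interpolable.
have bounded g : bounded_section U (fun q => `|lam q|) (fun q => ba_base (a q))
    (fun q => ba_act (a q) g (ba_base (a q))).
  (* The rescaled orbit bounds converge, since the lengths of the test words do and [84 * Delta] is
     scaled to [0]; hence they are eventually bounded. *)
  have h : `|lam q| * ((n g)%:R * growth (f q)) @[q --> U] -->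
      (n g)%:R * (\sum_(w <- test_words) `|c * M w| + 0 * (84 * Delta)).
    under eq_fun do rewrite mulrCA /growth mulrDr mulr_sumr.
    apply: cvgM; first exact: cvg_cst.
    apply: ultra_cvgD; last by apply: cvgM => //; exact: cvg_cst.
    apply: (@cvg_sumr R _ _ U _ _ (fun w q => `|lam q| * `|f q w|)) => w.
    under eq_fun do rewrite -[X in X * _]normr_id -normrM.
    by apply: cvg_norm; exact: cM.
  eexists; apply: filterS (cvg_near_le h) => q; apply: le_trans.
  by have [_ _ /(_ g) bP _] := aP q; rewrite ler_wpM2l.
pose T : metricType R :=
  pm_quot (ultralimit (UU := UU) (fun q => ba_base (a q)) lam_ge0).
pose sigma : {multiplicative G -> Isom T} := qact_isom lam_ge0 bounded.
exists T, sigma; split.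
  apply: four_point_R_tree (ultralimit_four_point fp nlam0) _ _.
    exact: ultralimit_interpolable.
  exact: ultralimit_nonempty.
have -> : length_function sigma = (fun g => c * M g).
  apply/funext => g; apply: ultralimit_length_function nlam0 fp ip _; exact: cM.
exact: projectivizes_to_scale.
Qed.

End LengthFunctionsOfThinActions.

Theorem corollary3p4 (R : realType) (G : groupType) (Delta : R)
    (G_fg : finitely_generated G) (Delta_gt0 : 0 < Delta) :
  let closure_L : set (LFbar R G) :=
    closure [set (inl L : LFbar R G) | L in length_functions_thin G Delta] in
  compact closure_L /\
  forall p : PLF R G, closure_L (inr p) ->
    exists (T : metricType R) (rho : {multiplicative G -> Isom T}),
      [/\ R_tree T, projectivizes_to (length_function rho) p
        & ~ exists x : T, global_fixed_point rho x].
Proof.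
move=> closure_L; have [S [n nP]] := finitely_generated_word_growth R G_fg.
split=> [|p /(thin_limit_tree Delta_gt0 nP)[T [rho [treeT rhop]]]].
  pose k (g : G) := (n g)%:R * (1 + 84 * Delta).
  have k0 g : 0 <= k g by rewrite mulr_ge0// addr_ge0// mulr_ge0// ltW.
  apply: (@subclosed_compact _ _ (tame (test_words S) k)).
  - exact: closed_closure.
  - exact: compact_tame.
  - rewrite /closure_L (closure_id (tame (test_words S) k)).1.
      by apply: closureS => _ [L Lthin <-]; exact: thin_tame_cone.
    exact: closed_tame.
(* A fixed point would make every translation length vanish, but a function with a projective class
   is nonzero. *)
exists T, rho; split=> // -[x fix_x].
apply: (projectivizes_to_neq0 rhop); apply/funext => g.
apply/eqP; rewrite eq_le; apply/andP; split.
  by have := translation_length_le (rho g) x; rewrite fix_x mdistxx.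
exact: (translation_length_ge0 (rho g)).
Qed.
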